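(* Let $k\ge 1$ be an integer, let $P=\mathrm{tconv}(\mathbf v_1,\dots,\mathbf v_k)\subset\mathbb R^k/\mathbb R\mathbbm{1}$ be a maximal biconvex polytope, and let $S$ be a finite set with a partition $S=\bigcup_{i\in[k]}S_i$ such that $|S_i|\ge 2$ for all $i\in[k]$. For each vertex $\mathbf w$ of $P$ let $G_{\mathbf w}$ be its directed bigraph and let $\Gamma[G_{\mathbf w}]$ be the associated gammoid on $S$. Then the collection of base polytopes $$\Sigma=\{\mathrm{BP}_{\Gamma[G_{\mathbf w}]}:\mathbf w\in\mathrm{Vert}(P)\}$$ is a matroid subdivision of the hypersimplex $\Delta_S^k$.
   Context: Notation: $[k]=\{1,\dots,k\}$; $\mathbbm 1=(1,\dots,1)\in\mathbb R^k$; $x(A)=\sum_{s\in A}x_s$. For $a\in\mathbb R$ and $\mathbf x,\mathbf y\in\mathbb R^k$ put $a\odot\mathbf x=a\mathbbm 1+\mathbf x$ and let $\mathbf x\boxplus\mathbf y$ be the entrywise minimum. A subset of $\mathbb R^k$ is tropically convex if it is closed under all tropical linear combinations $a_1\odot\mathbf x_1\boxplus\cdots\boxplus a_n\odot\mathbf x_n$ ($a_i\in\mathbb R$); $\mathrm{tconv}(V)$ is the smallest tropically convex set containing $V$. These notions descend to $\mathbb R^k/\mathbb R\mathbbm 1$. A biconvex polytope is an (ordinary) convex polytope in $\mathbb R^k/\mathbb R\mathbbm 1$ that is the tropical convex hull of finitely many points. A full-dimensional (i.e. $(k-1)$-dimensional) biconvex polytope $P$ has a unique inclusionwise minimal generating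 set, consisting of $k$ points $\mathbf v_1,\dots,\mathbf v_k$, all vertices of $P$, and $P$ has at most $\binom{2k-2}{k-1}$ vertices. $P$ is maximal if it is full-dimensional and has this maximum number of vertices. $\mathrm{Vert}(P)$ is the set of vertices of $P$. The generators are indexed so that $P=\bigcap_{i\in[k]}\bar E_i$, where $\bar E_i=\{\mathbf x: x_j-x_j(\mathbf v_i)\le x_i-x_i(\mathbf v_i)\text{ for all } j\in[k]\setminus\{i\}\}$ is the $i$-th max-sector with apex $\mathbf v_i$, and $x_j(\mathbf v)$ denotes the $j$-th coordinate of $\mathbf v$. For $l\ne i$, the $\{i,l\}$-facet of $\bar E_i$ is its subset where $x_l-x_l(\mathbf v_i)=x_i-x_i(\mathbf v_i)$. For $\mathbf w\in\mathrm{Vert}(P)$: $I^{\mathbf w}=\{i\in[k]:\mathbf w\text{ lies in some facet of }\bar E_i\}$, and for $i\in I^{\mathbf w}$, $C_i^{\mathbf w}=\{l\in[k]\setminus\{i\}:\mathbf w\in\text{the }\{i,l\}\text{-facet of }\bar E_i\}$. The directed graph $G_{\mathbf w}$ has node set $[k]$, and $(i,c)$ is an arrow if and only if $i\in I^{\mathbf w}$ and $c\in C_i^{\mathbf w}$; it is a directed bigraph with ordered parts $(I^{\mathbf w},[k]\setminus I^{\mathbf w})$ (all arrows go from the first part to the second). Gammoid of a directed graph: for a directed graph $G$ on node set $[k]$ without multiple arrows, and the partition $S=\bigcup_j S_j$, let $T(j)=\{l:(j,l)\text{ is an arrow of }G\}$ and $E_j=\bigcup_{l\in\{j\}\cup T(j)}S_l$.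 Then $\Gamma[G]=\bigvee_{j\in[k]}U^1_{E_j}$ is the matroid union of the rank-1 uniform matroids on the $E_j$, i.e. the rank-$k$ transversal matroid on $S$ presented by $(E_1,\dots,E_k)$. The base polytope $\mathrm{BP}_M\subset\mathbb R^S$ of a matroid $M$ on $S$ is the convex hull of the indicator vectors of its bases; $\Delta_S^k=[0,1]^S\cap\{x(S)=k\}$ is the base polytope of the uniform matroid $U_S^k$. Two polytopes are face-fitting if their intersection is a (possibly empty) common face of both. A tiling is a finite, pairwise face-fitting collection of polytopes in $\Delta_S^k$, all of the same dimension, that is connected in codimension 1. Its support is the union of its members. A matroid tiling is a tiling whose members are base polytopes of matroids. A matroid subdivision of $\Delta_S^k$ is a matroid tiling whose support is $\Delta_S^k$. *)

(* Defs.v *)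
From HB Require Import structures.
From mathcomp Require Import all_boot all_order all_algebra.
From mathcomp Require Import generic_quotient ring_quotient.
From mathcomp Require Import boolp classical_sets functions cardinality reals.
From mathcomp Require Import convex.

Set Implicit Arguments.
Unset Strict Implicit.
Unset Printing Implicit Defensive.

Import Order.TTheory GRing.Theory Num.Theory.
Export Quotient.Exports.

Local Open Scope quotient_scope.
Local Open Scope classical_set_scope.
Local Open Scope card_scope.
Local Open Scope ring_scope.

Section TropicalTorus.
Variables (R : realType) (k : nat).

Definition ones_line : {pred 'rV[R]_k} :=
  fun x => `[< exists a : R, x = const_mx a >].

Fact ones_line_zmod_closed : zmod_closed ones_line.
Proof.
split=> [|x y /asboolP[a ->] /asboolP[b ->]]; apply/asboolP.
  by exists 0; apply/rowP => i; rewrite !mxE.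
by exists (a - b); apply/rowP => i; rewrite !mxE.
Qed.

HB.instance Definition _ :=
  GRing.isZmodClosed.Build 'rV[R]_k ones_line ones_line_zmod_closed.

(** R^k / R(1,...,1), made below into a vector space over R. *)
Definition torus : Type := Quotient.quot ones_line.

HB.instance Definition _ := GRing.Zmodule.on torus.

Definition torus_pi (x : 'rV[R]_k) : torus := \pi_(Quotient.quot ones_line) x.

Definition torus_repr (x : torus) : 'rV[R]_k :=
  repr (x : Quotient.quot ones_line).

Fact torus_reprK : cancel torus_repr torus_pi.
Proof. exact: reprK. Qed.

Fact torus_piP (x y : 'rV[R]_k) :
  torus_pi x = torus_pi y <-> exists a : R, x - y = const_mx a.
Proof.
split=> [xy|[a xy]].
  have /asboolP // : x - y \in ones_line.
  by rewrite Quotient.idealrBE; apply/eqP.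
by apply/eqP; rewrite -Quotient.idealrBE; apply/asboolP; exists a.
Qed.

Fact torus_pi_zmod_morphism : zmod_morphism torus_pi.
Proof. exact: (raddfB (\pi_(Quotient.quot ones_line))). Qed.

HB.instance Definition _ :=
  GRing.isZmodMorphism.Build 'rV[R]_k torus torus_pi torus_pi_zmod_morphism.

Definition torus_scale (a : R) (x : torus) : torus :=
  torus_pi (a *: torus_repr x).

Fact torus_scale_pi (a : R) (x : 'rV[R]_k) :
  torus_scale a (torus_pi x) = torus_pi (a *: x).
Proof.
apply/torus_piP; rewrite -scalerBr.
have /torus_piP[b ->] : torus_pi (torus_repr (torus_pi x)) = torus_pi x.
  by rewrite torus_reprK.
by exists (a * b); apply/rowP => i; rewrite !mxE.
Qed.

Fact torus_scaleA (a b : R) (x : torus) :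
  torus_scale a (torus_scale b x) = torus_scale (a * b) x.
Proof. by rewrite -(torus_reprK x) !torus_scale_pi scalerA. Qed.

Fact torus_scale1 : left_id 1 torus_scale.
Proof. by move=> x; rewrite -(torus_reprK x) torus_scale_pi scale1r. Qed.

Fact torus_scaleDr : right_distributive torus_scale +%R.
Proof.
move=> a x y; rewrite -(torus_reprK x) -(torus_reprK y) -raddfD.
by rewrite !torus_scale_pi scalerDr raddfD.
Qed.

Fact torus_scaleDl (x : torus) : {morph torus_scale^~ x : a b / a + b}.
Proof.
by move=> a b; rewrite -(torus_reprK x) !torus_scale_pi scalerDl raddfD.
Qed.

HB.instance Definition _ := GRing.Zmodule_isLmodule.Build R torus
  torus_scaleA torus_scale1 torus_scaleDr torus_scaleDl.

Fact torus_pi_scalable : scalable torus_pi.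
Proof. by move=> a x; rewrite -torus_scale_pi. Qed.

HB.instance Definition _ :=
  GRing.isScalable.Build R 'rV[R]_k torus *:%R torus_pi torus_pi_scalable.

End TropicalTorus.

Section Polytopes.
Variables (R : realType) (V : lmodType R).
Implicit Types (A Q F : set V) (Sigma : set (set V)).

Definition conv_hull A : set V := smallest (@convex_set R V) A.

Definition polytope Q := exists2 A : set V, finite_set A & Q = conv_hull A.

(** Both [Q] itself and the empty set are faces of [Q]. *)
Definition is_face Q F := exists (f : {linear V -> R^o}) (c : R),
  (forall x, Q x -> f x <= c) /\ F = Q `&` [set x | f x = c].

Definition Vert Q : set V := [set w | is_face Q [set w]].

Definition affinely_independent n (p : 'I_n -> V) :=
  forall c : 'I_n -> R, \sum_i c i = 0 -> \sum_i c i *: p i = 0 ->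
    forall i, c i = 0.

(** [d] is the dimension of the affine span of [Q]; the empty set has no
    dimension in this sense. *)
Definition has_dim Q (d : nat) :=
  (exists2 p : 'I_d.+1 -> V, forall i, Q (p i) & affinely_independent p) /\
  (forall p : 'I_d.+2 -> V, (forall i, Q (p i)) -> ~ affinely_independent p).

Definition face_fitting Q1 Q2 :=
  is_face Q1 (Q1 `&` Q2) /\ is_face Q2 (Q1 `&` Q2).

(** Any two members are joined by a chain of members in which consecutive ones
    meet in dimension one less than their common dimension [d]. *)
Definition connected_in_codim1 (d : nat) Sigma :=
  forall Q Q', Sigma Q -> Sigma Q' ->
    exists (n : nat) (T : nat -> set V),
      [/\ T 0%N = Q, T n = Q',
          forall i, (i <= n)%N -> Sigma (T i) &
          forall i, (i < n)%N ->
            exists2 e, d = e.+1 & has_dim (T i `&` T i.+1) e].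

Definition tiling_in (D : set V) Sigma :=
  [/\ finite_set Sigma,
      forall Q, Sigma Q -> polytope Q /\ Q `<=` D,
      forall Q Q', Sigma Q -> Sigma Q' -> Q <> Q' -> face_fitting Q Q' &
      exists2 d, forall Q, Sigma Q -> has_dim Q d
               & connected_in_codim1 d Sigma].

Definition tiling_support Sigma : set V := \bigcup_(Q in Sigma) Q.

End Polytopes.

Section TropicalConvexity.
Variables (R : realType) (k : nat).

Definition trop_scale (a : R) (x : 'rV[R]_k) : 'rV[R]_k := const_mx a + x.

Definition trop_add (x y : 'rV[R]_k) : 'rV[R]_k :=
  \row_j Num.min (x 0 j) (y 0 j).

(** [trop_add] has no neutral element in R^k; being idempotent, it can be
    iterated starting from the first term. *)
Definition trop_comb n (a : 'I_n.+1 -> R) (x : 'I_n.+1 -> 'rV[R]_k) :=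
  \big[trop_add/trop_scale (a ord0) (x ord0)]_(i < n.+1)
    trop_scale (a i) (x i).

Definition trop_convex (A : set 'rV[R]_k) :=
  forall n (a : 'I_n.+1 -> R) (x : 'I_n.+1 -> 'rV[R]_k),
    (forall i, A (x i)) -> A (trop_comb a x).

Definition torus_trop_convex (A : set (torus R k)) :=
  trop_convex [set x | A (torus_pi x)].

Definition tconv (A : set (torus R k)) : set (torus R k) :=
  smallest torus_trop_convex A.

Definition biconvex_polytope (P : set (torus R k)) :=
  polytope P /\ exists2 A, finite_set A & P = tconv A.

Definition maximal_biconvex (P : set (torus R k)) :=
  [/\ biconvex_polytope P, has_dim P k.-1 &
      Vert P #= `I_('C(2 * k - 2, k.-1))].

Definition minimal_generating_set (P A : set (torus R k)) :=
  P = tconv A /\ forall B, B `<=` A -> P = tconv B -> B = A.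

(** The difference [x_j - x_i] of two coordinates of a point of R^k/R1, which
    does not depend on the representative. *)
Definition coord_diff (x : torus R k) (j i : 'I_k) : R :=
  torus_repr x 0 j - torus_repr x 0 i.

(** The condition [x_j - x_j(v) <= x_i - x_i(v)], in terms of differences of
    coordinates. *)
Definition max_sector (v : torus R k) (i : 'I_k) : set (torus R k) :=
  [set x | forall j, j != i -> coord_diff x j i <= coord_diff v j i].

Definition sector_facet (v : torus R k) (i l : 'I_k) : set (torus R k) :=
  max_sector v i `&` [set x | coord_diff x l i = coord_diff v l i].

Definition sector_indices (v : 'I_k -> torus R k) (w : torus R k) :
    {set 'I_k} :=
  [set i | `[< exists2 l, l != i & sector_facet (v i) i l w >]]%SET.

Definition facet_indices (v : 'I_k -> torus R k) (w : torus R k) (i : 'I_k) :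
    {set 'I_k} :=
  [set l | (l != i) && `[< sector_facet (v i) i l w >]]%SET.

Definition vertex_graph (v : 'I_k -> torus R k) (w : torus R k) : rel 'I_k :=
  fun i c => (i \in sector_indices v w) && (c \in facet_indices v w i).

End TropicalConvexity.

Section Matroids.
Variable S : finType.

(** A matroid on [S] is given by its family of independent sets. *)
Definition is_matroid (M : {set {set S}}) :=
  [/\ (exists A, A \in M),
      forall A B : {set S}, A \subset B -> B \in M -> A \in M &
      forall A B : {set S}, A \in M -> B \in M -> (#|A| < #|B|)%N ->
        exists x, [/\ x \in B, x \notin A & (x |: A)%SET \in M]].

Definition bases (M : {set {set S}}) : {set {set S}} :=
  [set B | maxset (fun A => A \in M) B]%SET.

(** [U^r_E], the elements of [S] outside [E] being loops. *)
Definition uniform_matroid (r : nat) (E : {set S}) : {set {set S}} :=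
  [set A : {set S} | (A \subset E) && (#|A| <= r)%N]%SET.

Definition matroid_union k (M : 'I_k -> {set {set S}}) : {set {set S}} :=
  [set A | [exists J : {ffun 'I_k -> {set S}},
     [forall j, J j \in M j] && (A == \bigcup_j J j)%SET]]%SET.

Definition graph_block k (Sp : 'I_k -> {set S}) (G : rel 'I_k) (j : 'I_k) :
    {set S} :=
  (\bigcup_(l | (l == j) || G j l) Sp l)%SET.

Definition gammoid k (Sp : 'I_k -> {set S}) (G : rel 'I_k) : {set {set S}} :=
  matroid_union (fun j => uniform_matroid 1 (graph_block Sp G j)).

Definition is_partition k (Sp : 'I_k -> {set S}) :=
  (\bigcup_i Sp i = [set: S])%SET /\
  forall i j, i != j -> [disjoint Sp i & Sp j]%B.

Variable R : realType.

Definition indicator (B : {set S}) : {ffun S -> R^o} :=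
  [ffun s => (s \in B)%:R].

Definition base_polytope (M : {set {set S}}) : set {ffun S -> R^o} :=
  conv_hull [set indicator B | B in [set B | B \in bases M]].

Definition hypersimplex (k : nat) : set {ffun S -> R^o} :=
  [set x | (forall s, 0 <= x s <= 1) /\ \sum_s x s = k%:R].

Definition matroid_tiling (k : nat) (Sigma : set (set {ffun S -> R^o})) :=
  tiling_in (hypersimplex k) Sigma /\
  forall Q, Sigma Q -> exists2 M, is_matroid M & Q = base_polytope M.

Definition matroid_subdivision (k : nat) (Sigma : set (set {ffun S -> R^o})) :=
  matroid_tiling k Sigma /\ tiling_support Sigma = hypersimplex k.

End Matroids.

(* Main.v *)
Require Import Defs.
From HB Require Import structures.
From mathcomp Require Import all_boot all_order all_algebra.
From mathcomp Require Import boolp classical_sets functions cardinality reals.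
From mathcomp Require Import unstable convex interval_inference.
From mathcomp Require Import ring lra zify.

Set Implicit Arguments.
Unset Strict Implicit.
Unset Printing Implicit Defensive.

Import Order.TTheory GRing.Theory Num.Theory.

Local Open Scope classical_set_scope.
Local Open Scope ring_scope.

(** Write c i j for the difference of the coordinates j and i of the generator
    v i; then P is the set of the w with w j - w i <= c i j for all i and j,
    and the arrows of the graph of w are the pairs with distinct i and j where
    this is an equality.
    The vertices of P are the points whose graph is connected
    ([Vert_vertex]).

    The cells are recognised as the regions of linearity of the support
    function of P.  For x in the hypersimplex let y j be the mass of x on the
    block j.  The base polytope of the gammoid of w is the set of those x for
    which w maximises the linear form with coefficients y j - 1 on P
    ([base_polytope_cell]).  This makes the subdivision almost formal: every
    form attains its maximum at a vertex, so the cells cover, and the common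
    part of the cells of w and w' is cut out of the first one by the linear
    inequality comparing the values at w and w', so it is a face
    ([cell_face]).

    Maximality of P is used in a count ([selects_determined]).  A
    spanning tree in the graph of w gives a vector d of natural numbers with
    sum k - 1, the out-degrees of the tree, such that w is the only point of
    P that maximises the form with coefficients 1 - 1/k - d j.  Vectors of
    different vertices are therefore different, and there are exactly
    'C(2k - 2, k - 1) vectors, so a P with that many vertices leaves each
    vertex only one vector.  A graph containing two spanning trees would give
    two, hence every arrow is a bridge ([vertex_cuts]): it is the only arrow
    between the two sides C i l and its complement.  The cell of w then has
    the facet description x(C i l) >= |C i l|, over the arrows (i, l)
    ([cellP]).

    Everything else uses these cuts.  The graph is bipartite, because a path
    of length two would be closed to a triangle by the triangle inequality for
    c ([tight_no_path]).  Points of a cell are rounded to integral ones by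
    moving mass between two fractional coordinates that no tight cut separates
    ([cell_integral_hull]), and an integral point is a basis since the bridge
    tree routes the surplus of each block ([integral_cell_basis]).  Decreasing
    the coordinates of w on one C i l until a new inequality becomes an
    equality gives a neighbouring vertex ([pivot]) whose cell meets that of w in dimension one
    less ([facet_dim], [cell_pivot]); such pivots, as in the simplex method,
    reach any prescribed vertex ([cells_chained]). *)

(** * Margins in finite systems of inequalities *)

(** The ratio test of the simplex method: moving along d is possible up to the
    first moment at which a decreasing slack vanishes. *)
Lemma ratio_test (R : realFieldType) (I : finType) (s d : I -> R) :
  (forall i, 0 <= s i) -> (forall i, s i = 0 -> 0 <= d i) ->
  (exists i, d i < 0) ->
  exists2 t, 0 < t & (forall i, 0 <= s i + t * d i) /\
                     exists2 i, d i < 0 & s i + t * d i = 0.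
Proof.
move=> s_ge0 d_ge0 [i0 di0].
case: (@arg_minP _ _ _ i0 (fun i => d i < 0) (fun i => s i / - d i) di0).
move=> i di_lt0 imin.
have si_gt0 : 0 < s i.
  rewrite lt_def s_ge0 andbT; apply/eqP => si0.
  by have := d_ge0 _ si0; rewrite leNgt di_lt0.
exists (s i / - d i); first by rewrite divr_gt0 ?oppr_gt0.
split=> [j|]; last first.
  by exists i => //; field; lra.
have [dj|dj] := ltP (d j) 0; last first.
  by rewrite addr_ge0// mulr_ge0// divr_ge0 ?oppr_ge0// ltW.
have := imin j dj; rewrite ler_pdivlMr ?oppr_gt0// => le1; lra.
Qed.

Lemma finite_margin (R : realFieldType) (I : finType) (s : I -> R) :
  (forall i, 0 < s i) -> exists2 t, 0 < t & forall i, t <= s i.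
Proof.
move=> s_gt0; have [i0 _|I0] := pickP (fun _ : I => true); last first.
  by exists 1 => // i; have := I0 i.
case: (@arg_minP _ _ _ i0 (fun=> true) s isT) => i _ imin.
by exists (s i) => // j; apply: imin.
Qed.

(** * Alcoved polytopes and their vertices *)
Section Potentials.
Variables (R : realFieldType) (k : nat) (c : 'I_k -> 'I_k -> R).
Implicit Types (u w z : 'I_k -> R) (A : pred 'I_k) (d : 'I_k -> nat).

Definition feasible w := forall i j, w j - w i <= c i j.

Definition tight w : rel 'I_k := fun i j => (i != j) && (w j - w i == c i j).

(** Equality modulo translation by a multiple of (1, ..., 1). *)
Definition same_point u w := forall i j, u j - u i = w j - w i.

(** Connectedness of the underlying undirected graph. *)
Definition connected (e : rel 'I_k) :=
  forall A, (forall i j, e i j -> A i = A j) -> forall i j, A i = A j.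

(** This agrees with the exposed points of the polytope: see [Vert_vertex]. *)
Definition vertex w := feasible w /\ connected (tight w).

Lemma connected_const (e : rel 'I_k) z :
  connected e -> (forall i j, e i j -> z i = z j) -> forall i j, z i = z j.
Proof.
move=> e_conn ze i j; apply/esym/eqP.
have ze_i a b : e a b -> (z a == z i) = (z b == z i) by move/ze ->.
by rewrite -(e_conn (fun m => z m == z i) ze_i i j).
Qed.

Lemma connected_cross (e : rel 'I_k) A i j :
  connected e -> A i -> ~~ A j -> exists a b, e a b /\ A a != A b.
Proof.
move=> e_conn Ai Aj.
case: (pickP (fun ab => e ab.1 ab.2 && (A ab.1 != A ab.2))) => [[a b]/=|no].
  by case/andP => eab Aab; exists a, b.
have /e_conn/(_ i j) : forall a b, e a b -> A a = A b.
  by move=> a b eab; have /= := no (a, b); rewrite eab => /negbFE/eqP.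
by rewrite Ai (negPf Aj).
Qed.

Lemma same_point_sym u w : same_point u w -> same_point w u.
Proof. by move=> uw i j; rewrite uw. Qed.

Lemma same_point_tight u w : same_point u w -> tight u = tight w.
Proof.
by move=> uw; apply/funext => i; apply/funext => j; rewrite /tight uw.
Qed.

Lemma tight_le w u i j :
  tight w i j -> feasible u -> u j - w j <= u i - w i.
Proof. by case/andP => _ /eqP tij /(_ i j); rewrite -tij; lra. Qed.

(** For A everything, this says that w is the unique maximum, modulo
    translation, of the linear form with coefficients 1 - d j - p j.  The
    general case allows A to be built up node by node.  The weights p are kept
    arbitrary because the induction needs it: when a node joins A, its weight
    has to be taken from a node already present.  In the end p is the constant
    1/k. *)
Definition selects w A d :=
  [/\ (\sum_(j | A j) d j).+1 = #|A|, forall j, ~~ A j -> d j = 0%N &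
   forall p : 'I_k -> R, (forall j, A j -> 0 < p j) -> \sum_(j | A j) p j = 1 ->
   forall u, feasible u ->
     let L := \sum_(j | A j) (1 - (d j)%:R - p j) * (u j - w j) in
     L <= 0 /\ (L = 0 -> forall i j, A i -> A j -> u i - w i = u j - w j)].

Definition adjoin A a b : pred 'I_k := [pred j | [|| A j, j == a | j == b]].

(** Let n be the new node and m the old end of the arrow.  Apply the hypothesis
    on A with the weight of n added to that of m.  The new form differs from
    the old one by a positive multiple of z b - z a, where z = u - w, and this
    difference is nonpositive because the arrow (a, b) is tight at w. *)
Lemma selects_extend w A d a b :
  selects w A d -> tight w a b -> A a != A b ->
  selects w (adjoin A a b) (fun j => d j + (j == a))%N.
Proof.
move=> [card_d d0 dL] tab Aab.
pose m := if A a then a else b; pose n := if A a then b else a.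
have Am : A m by rewrite /m; case: ifP Aab => //; case: (A b).
have An : ~~ A n.
  by rewrite /n; case: ifP Aab => [_|->//]; case: (A b).
have nm : n != m by apply: contraNneq An => ->.
have adjE : adjoin A a b =1 [pred j | (j == n) || A j].
  move=> j; move: Am; rewrite /adjoin /m /n /=; case Aa: (A a) => Am.
    by have [->|_] := eqVneq j a; [rewrite Aa !orbT|rewrite orbC].
  by have [->|_] := eqVneq j b; [rewrite Am !orbT|rewrite orbF orbC].
have sumE (V : nmodType) (F : 'I_k -> V) :
    \sum_(j | adjoin A a b j) F j = F n + \sum_(j | A j) F j.
  rewrite (eq_bigl _ _ adjE) (bigD1 n) /= ?eqxx//; congr (_ + _).
  apply: eq_bigl => j; have [->|//] := eqVneq j n; last by rewrite andbT.
  by rewrite (negPf An) andbF.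
have sumEn (F : 'I_k -> nat) :
    (\sum_(j | adjoin A a b j) F j = F n + \sum_(j | A j) F j)%N.
  exact: (sumE nat).
have an : (n == a) = ~~ A a.
  rewrite /n; case: ifPn => Aa; last exact: eqxx.
  by apply: contraNF Aab => /eqP ->.
have am : (m == a) = A a.
  rewrite /m; case: ifPn => Aa; first exact: eqxx.
  by apply: contraNF Aab => /eqP ->.
have dltm (V : pzSemiRingType) (F : 'I_k -> V) :
    \sum_(j | A j) (j == m)%:R * F j = F m.
  rewrite (bigD1 m)//= eqxx mul1r big1 ?addr0// => j /andP[_ /negPf->].
  by rewrite mul0r.
have sumA : (\sum_(j | A j) (j == a) = A a)%N.
  case Aa: (A a).
    rewrite (bigD1 a)//= eqxx big1 ?addn0// => j /andP[_ /negPf->]//.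
  rewrite big1// => j Aj; apply/eqP; rewrite eqb0.
  by apply: contraTneq Aj => ->; rewrite Aa.
split=> [|j|p p_gt0 p1 u uF].
- rewrite sumEn big_split /= sumA (d0 n An) an -sum1_card.
  rewrite (sumEn (fun=> 1%N)) (sum1_card A) -card_d.
  by move: (\sum_(j | A j) d j)%N => D; case: (A a) => /=; lia.
- rewrite [adjoin _ _ _ _]adjE /= negb_or => /andP[jn Aj].
  rewrite (d0 j Aj); apply/eqP; rewrite add0n eqb0.
  by apply: contra jn => /eqP ja; rewrite ja eq_sym an -ja.
(* The weight of the new node is lent to its neighbour m. *)
pose p' j := p j + (j == m)%:R * p n.
have adjA j : A j -> adjoin A a b j by move=> Aj; rewrite /adjoin /= Aj.
have adjn : adjoin A a b n by rewrite [adjoin _ _ _ _]adjE /= eqxx.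
have pn := p_gt0 n adjn; have pm := p_gt0 m (adjA m Am).
have p'_gt0 j : A j -> 0 < p' j.
  by move=> Aj; rewrite ltr_pwDl ?p_gt0 ?adjA// mulr_ge0// ltW.
have p'1 : \sum_(j | A j) p' j = 1.
  by rewrite big_split /= (dltm _ (fun=> p n)) addrC -sumE.
have pn1 : p n < 1.
  rewrite -p1 sumE ltrDl (bigD1 m)//= ltr_pwDl// sumr_ge0// => j /andP[Aj _].
  by rewrite ltW// p_gt0// adjA.
have [L_le0 L_eq0] := dL p' p'_gt0 p'1 u uF.
set L := \sum_(j | A j) _ in L_le0 L_eq0.
move: (tight_le tab uF); pose zz j := u j - w j; rewrite -!/(zz _) => z_le.
have LE : \sum_(j | adjoin A a b j)
     (1 - (d j + (j == a))%N%:R - p j) * (u j - w j) =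
    L + (1 - (~~ A a)%:R - p n) * zz n + (p n - (A a)%:R) * zz m.
  rewrite sumE d0// an add0n -/(zz n).
  suff -> : \sum_(i | A i) (1 - (d i + (i == a))%:R - p i) * (u i - w i) =
      L + (p n - (A a)%:R) * zz m by ring.
  rewrite -(dltm _ (fun j => (p n - (A a)%:R) * zz j)) /L -big_split /=.
  apply: eq_bigr => j Aj; rewrite /p' /zz natrD.
  have -> : (j == a) = A a && (j == m).
    case Aa: (A a); first by move: am; rewrite Aa => /eqP ->.
    by apply/negbTE; apply: contraTneq Aj => ->; rewrite Aa.
  by case: (A a); case: (j == m) => /=; ring.
rewrite /= LE; move: z_le; rewrite /n /m.
have key (mm nn : 'I_k) (q : R) : 0 < q -> zz nn <= zz mm ->
    L + q * (zz nn - zz mm) <= 0 /\ (L + q * (zz nn - zz mm) = 0 ->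
      L = 0 /\ zz nn = zz mm).
  move=> q0 zle; have le0 : q * (zz nn - zz mm) <= 0.
    by rewrite pmulr_rle0// subr_le0.
  split=> [|e]; first by lra.
  have L0 : L = 0 by lra.
  split=> //; move: e; rewrite L0 add0r => /eqP; rewrite mulf_eq0 gt_eqF//=.
  by rewrite subr_eq0 => /eqP.
have fin : L = 0 /\ zz n = zz m -> forall i j,
    adjoin A a b i -> adjoin A a b j -> u i - w i = u j - w j.
  move=> [/L_eq0 cst znm].
  suff H i : adjoin A a b i -> zz i = zz m.
    by move=> i j /H + /H; rewrite /zz => -> ->.
  rewrite [adjoin _ _ _ _]adjE /= => /orP[/eqP ->//|Ai]; exact: cst.
move: pn pn1 fin; rewrite /n /m; case: ifP => Aa pn pn1 fin z_le /=.
- have [le0 eq0] := key a b (1 - p b) ltac:(lra) z_le.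
  have -> : L + (1 - 0%:R - p b) * zz b + (p b - 1%:R) * zz a =
            L + (1 - p b) * (zz b - zz a) by ring.
  by split=> // /eq0/fin.
- have [le0 eq0] := key a b (p a) pn z_le.
  have -> : L + (1 - 1%:R - p a) * zz a + (p a - 0%:R) * zz b =
            L + p a * (zz b - zz a) by ring.
  by split=> // /eq0[L0 e]; apply: fin.
Qed.

Lemma adjoin_proper A a b :
  A a != A b -> (#|[predC adjoin A a b]| < #|[predC A]|)%N.
Proof.
move=> Aab; apply: proper_card; apply/properP; split.
  apply/fintype.subsetP => x; rewrite !inE /adjoin; apply: contra => Ax.
  by apply/orP; left.
move: Aab; case Aa: (A a); case Ab: (A b) => // _.
  by exists b; [exact: negbT Ab|rewrite /adjoin inE negbK inE eqxx !orbT].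
by exists a; [exact: negbT Aa|rewrite /adjoin inE negbK inE eqxx !orbT].
Qed.

Lemma selects_seed w i : selects w (pred1 i) (fun=> 0%N).
Proof.
split=> [|//|p _ p1 u _ /=]; first by rewrite big1// card1.
rewrite !big_pred1_eq in p1 *; rewrite p1 subr0 subrr mul0r; split=> // _ a b.
by move=> /eqP-> /eqP->.
Qed.

(** The increment e comes from a way of growing A to the whole of [k] along
    arrows; it is chosen before d, so that two vectors d that differ on A stay
    different. *)
Lemma selects_complete w A i : connected (tight w) -> A i ->
  exists e, forall d, selects w A d -> selects w predT (fun j => d j + e j)%N.
Proof.
move=> w_conn; have [n] := ubnP #|[predC A]|; elim: n A => // n IH A ltn Ai.
have [j Aj|Afull] := pickP [predC A]; last first.
  exists (fun=> 0%N) => d; have -> : A = predT.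
    by apply/funext => j; have /negbFE := Afull j.
  by congr selects; apply/funext => j; rewrite addn0.
have [a [b [tab Aab]]] := connected_cross w_conn Ai Aj.
have [||e eP] := IH (adjoin A a b).
- exact: leq_trans (adjoin_proper Aab) ltn.
- by rewrite /adjoin /= Ai.
exists (fun j => (j == a) + e j)%N => d /selects_extend/(_ tab Aab)/eP.
by congr selects; apply/funext => x; rewrite addnA.
Qed.

Lemma selects_ex w (i : 'I_k) :
  connected (tight w) -> exists d, selects w predT d.
Proof.
move=> w_conn; have [e eP] := @selects_complete w (pred1 i) i w_conn (eqxx i).
by exists (fun j => 0 + e j)%N; apply: eP; apply: selects_seed.
Qed.

(** Grow a set from i without using the arrow (i, l), until l is about to join
    it through another arrow (a, b).  At that moment l may join through (a, b)
    or through (i, l), which increments the vector at a or at i, and a is not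
    i. *)
Lemma selects_two w i l : connected (tight w) -> tight w i l ->
  connected [rel a b | tight w a b && ((a, b) != (i, l))] ->
  exists d1 d2, [/\ selects w predT d1, selects w predT d2 &
                    exists j, d1 j <> d2 j].
Proof.
move=> w_conn til min_conn.
have il : i != l by case/andP: til.
suff grow A d : selects w A d -> A i -> ~~ A l ->
    exists d1 d2, [/\ selects w predT d1, selects w predT d2 &
      exists j, d1 j <> d2 j].
  by apply: (grow _ _ (selects_seed w i)); rewrite /= ?eqxx// eq_sym.
have [n] := ubnP #|[predC A]|; elim: n A d => // n IH A d ltn dA Ai Al.
have [a [b [/=/andP[tab nab] Aab]]] := connected_cross min_conn Ai Al.
have [abl|abl] := boolP ((a == l) || (b == l)); last first.
  apply: IH (selects_extend dA tab Aab) _ _.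
  - exact: leq_trans (adjoin_proper Aab) ltn.
  - by rewrite /adjoin /= Ai.
  - by rewrite /adjoin /= (negPf Al) ![l == _]eq_sym.
have Ail : A i != A l by rewrite Ai (negPf Al).
have ai : a != i.
  apply: contraNneq nab => ai; rewrite ai in abl Aab *.
  by move: abl; rewrite (negPf il) /= => /eqP ->.
have same_adj : adjoin A a b = adjoin A i l.
  apply/funext => x; rewrite /adjoin /=.
  have [->|xi] := eqVneq x i; first by rewrite Ai.
  have Axab y : A y -> (x == y) || A x = A x.
    by have [->|//] := eqVneq x y; move=> ->.
  case/orP: abl => /eqP abl; rewrite abl in Aab *.
    have Ab : A b by move: Aab; rewrite (negPf Al); case: (A b).
    by have := Axab _ Ab; case: (x == b); case: (A x); case: (x == l).
  have Aa : A a by move: Aab; rewrite (negPf Al); case: (A a).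
  by have := Axab _ Aa; case: (x == a); case: (A x); case: (x == l).
have [e eP] := @selects_complete w (adjoin A i l) i w_conn
  ltac:(by rewrite /adjoin /= Ai).
exists (fun j => d j + (j == i) + e j)%N.
exists (fun j => d j + (j == a) + e j)%N; split.
- exact: eP (selects_extend dA til Ail).
- by apply: eP; rewrite -same_adj; apply: selects_extend dA tab Aab.
by exists i; rewrite eqxx eq_sym (negPf ai); lia.
Qed.

(** Two points that maximise the same form, one of them uniquely, coincide. *)
Lemma selects_inj u w d : feasible u -> feasible w ->
  selects u predT d -> selects w predT d -> same_point u w.
Proof.
move=> uF wF [_ _ du] [_ _ dw] i j.
have k_gt0 : (0 < k)%N by case: (k) i => [[]|].
have k0 : (k%:R : R) != 0 by rewrite pnatr_eq0 -lt0n.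
pose p (_ : 'I_k) : R := k%:R^-1.
have p_gt0 a : predT a -> 0 < p a by rewrite invr_gt0 ltr0n.
have p1 : \sum_a p a = 1.
  by rewrite sumr_const card_ord -[LHS]mulr_natr mulVf.
have [+ +] := du p p_gt0 p1 w wF; have [+ _] := dw p p_gt0 p1 u uF.
rewrite /=; set L := \sum_a _; set M := \sum_a _.
have -> : M = - L.
  by rewrite -sumrN; apply: eq_bigr => a _; ring.
move=> le1 le2 L0; have := L0 ltac:(lra) i j isT isT.
lra.
Qed.

(** * Counting the vertices *)

(** The family vtx lists, without repetition, as many vertices as a maximal
    polytope has; [vtx_surj] below says that it lists all of them. *)
Section Counting.
Variable vtx : 'I_('C(2 * k - 2, k.-1)) -> 'I_k -> R.
Hypothesis vtx_vertex : forall n, vertex (vtx n).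
Hypothesis vtx_inj : forall m n, same_point (vtx m) (vtx n) -> m = n.

(** Choosing one vector for each vertex is an injection into the vectors of
    k natural numbers with sum k - 1.  There are as many of these as vertices,
    so the choice is onto, and a second vector of a vertex would be the chosen
    vector of another one. *)
Lemma selects_determined n d1 d2 :
  selects (vtx n) predT d1 -> selects (vtx n) predT d2 -> d1 =1 d2.
Proof.
case: (posnP k) => [k0 _ _ [i ltik]|k_gt0]; first by exfalso; rewrite k0 in ltik.
have [D DP] := boolp.choice (fun m =>
  selects_ex (Ordinal k_gt0) (proj2 (vtx_vertex m))).
(* The counting lemma for compositions speaks of tuples of length m.+1. *)
pose castk := cast_ord (prednK k_gt0).
have sum_castk (d : 'I_k -> nat) : (\sum_(i < k.-1.+1) d (castk i) = \sum_j d j)%N.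
  rewrite [RHS](reindex castk) //=.
  by exists (cast_ord (esym (prednK k_gt0))) => i _; apply: val_inj.
pose code (d : 'I_k -> nat) : k.-1.+1.-tuple 'I_k.-1.+1 :=
  [tuple inord (d (castk i)) | i < k.-1.+1].
have codeE d i : (\sum_j d j)%N = k.-1 ->
    tnth (code d) i = d (castk i) :> nat.
  move=> sum_d; rewrite tnth_mktuple inordK// ltnS -sum_d.
  by rewrite -sum_castk (bigD1 i)//= leq_addr.
have sum_sel u d : selects u predT d -> (\sum_j d j)%N = k.-1.
  by case=> [s _ _]; apply: succn_inj; rewrite prednK//; exact: etrans s (card_ord k).
pose T := [set t : k.-1.+1.-tuple 'I_k.-1.+1 | (\sum_(i <- t) i)%N == k.-1]%SET.
have codeT d : (\sum_j d j)%N = k.-1 -> code d \in T.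
  move=> sum_d; rewrite inE big_tuple; apply/eqP.
  by apply: (etrans _ sum_d); rewrite -sum_castk; apply: eq_bigr => i _; rewrite codeE.
have code_inj d1' d2' : (\sum_j d1' j)%N = k.-1 -> (\sum_j d2' j)%N = k.-1 ->
    code d1' = code d2' -> d1' =1 d2'.
  move=> s1 s2 e12 j; have -> : j = castk (cast_ord (esym (prednK k_gt0)) j).
    exact: val_inj.
  by rewrite -!codeE// e12.
have codeD_inj : injective (fun m => code (D m)).
  move=> m1 m2 /code_inj e12; apply: vtx_inj.
  apply: selects_inj (proj1 (vtx_vertex m1)) (proj1 (vtx_vertex m2)) (DP m1) _.
  have -> : D m1 = D m2; last exact: DP.
  by apply/funext => j; apply: e12; apply: sum_sel.
have codeD_surj t : t \in T -> exists m, t = code (D m).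
  move=> tT; suff : t \in [set code (D m) | m in [set: 'I_('C(2 * k - 2, k.-1))]]%SET.
    by case/imsetP => m _ ->; exists m.
  suff -> : [set code (D m) | m in [set: 'I_('C(2 * k - 2, k.-1))]]%SET = T by [].
  apply/eqP; rewrite eqEcard card_imset// cardsT card_ord card_ord_partitions.
  rewrite (_ : k.-1 + k.-1 = 2 * k - 2)%N ?leqnn ?andbT; last by lia.
  by apply/fintype.subsetP => _ /imsetP[m _ ->]; rewrite codeT// (sum_sel _ _ (DP m)).
suff H d : selects (vtx n) predT d -> d =1 D n by move=> /H + /H + j => -> ->.
move=> dn; have [m /code_inj dm] := codeD_surj _ (codeT _ (sum_sel _ _ dn)).
have {}dm : d = D m by apply/funext/dm; [exact: sum_sel dn|exact: sum_sel (DP m)].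
suff <- : m = n by rewrite dm.
apply: vtx_inj; apply: selects_inj (proj1 (vtx_vertex m)) (proj1 (vtx_vertex n)) (DP m) _.
by rewrite -dm.
Qed.

Hypothesis vtx_surj : forall w, vertex w -> exists n, same_point w (vtx n).

Lemma vertex_minimal w i l : vertex w -> tight w i l ->
  ~ connected [rel a b | tight w a b && ((a, b) != (i, l))].
Proof.
move=> wV; have [n /same_point_tight ->] := vtx_surj wV => til min_conn.
have [d1 [d2 [d1P d2P [j]]]] := selects_two (proj2 (vtx_vertex n)) til min_conn.
by apply; apply: selects_determined d1P d2P j.
Qed.

(** * Cuts *)

(** The arrow (i, l) enters C i l and no other arrow crosses its boundary. *)
Definition cut_system w (C : 'I_k -> 'I_k -> pred 'I_k) :=
  forall i l, tight w i l -> [/\ C i l l, ~~ C i l i &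
    forall a b, tight w a b -> (a, b) != (i, l) -> C i l a = C i l b].

(** Removing the arrow disconnects the graph by [vertex_minimal]; take the side
    that contains l. *)
Lemma vertex_cuts w : vertex w -> exists C, cut_system w C.
Proof.
move=> wV; have H (il : 'I_k * 'I_k) : exists D : pred 'I_k,
    tight w il.1 il.2 -> [/\ D il.2, ~~ D il.1 &
      forall a b, tight w a b -> (a, b) != il -> D a = D b].
  case: il => i l /=; have [til|_] := boolP (tight w i l); last by exists predT.
  have [A Aclosed [p [q Apq]]] : exists2 A : pred 'I_k,
      (forall a b, tight w a b -> (a, b) != (i, l) -> A a = A b) &
      exists p q, A p <> A q.
    apply: contrapT => noA; apply: (vertex_minimal wV til) => A Acl p q.
    apply: contrapT => Apq; apply: noA; exists A; last by exists p, q.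
    by move=> a b tab abil; apply: Acl; rewrite /= tab.
  have Ail : A i != A l.
    apply/eqP => Ail; apply: Apq; apply: (proj2 wV) => a b tab.
    by have [[-> ->]//|abil] := eqVneq (a, b) (i, l); apply: Aclosed.
  exists (fun j => A j (+) A i) => _; split.
  - by move: Ail; case: (A i); case: (A l).
  - by rewrite addbb.
  - by move=> a b tab /(Aclosed _ _ tab) ->.
have [C CP] := boolp.choice H.
by exists (fun i l => C (i, l)) => i l til; apply: CP.
Qed.

Definition dot (g z : 'I_k -> R) := \sum_j g j * z j.

(** Forms whose coefficients sum to zero live on the quotient by (1, ..., 1). *)
Lemma dot_same_point g u w : \sum_j g j = 0 -> same_point u w ->
  dot g u = dot g w.
Proof.
case: (posnP k) => [k0 _ _|k_gt0 g0 uw].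
  by rewrite /dot !big1// => -[i ltik]; exfalso; rewrite k0 in ltik.
pose i0 := Ordinal k_gt0.
apply/eqP; rewrite -subr_eq0 /dot -sumrB.
rewrite (eq_bigr (fun j => g j * (u i0 - w i0))); last first.
  by move=> j _; have := uw i0 j; rewrite -mulrBr => e; congr (_ * _); lra.
by rewrite -mulr_suml g0 mul0r.
Qed.

Section VertexCuts.
Variables (w : 'I_k -> R) (C : 'I_k -> 'I_k -> pred 'I_k).
Hypotheses (w_vertex : vertex w) (Cw : cut_system w C).

Lemma cut_arrow i l a b : tight w i l -> tight w a b ->
  (C i l b)%:R - (C i l a)%:R = ((a, b) == (i, l))%:R :> R.
Proof.
move=> /Cw[Cl Ci Cab] tab; have [[-> ->]|abil] := eqVneq (a, b) (i, l).
  by rewrite Cl (negPf Ci) subr0.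
by rewrite (Cab _ _ tab abil) subrr.
Qed.

(** The indicators of the cuts are dual to the arrows: along an arrow only the
    indicator of its own cut jumps.  Both sides thus have the same differences
    along every arrow, and the graph is connected. *)
Lemma cut_expansion z p q :
  z q - z p = \sum_i \sum_(l | tight w i l)
    (z l - z i) * ((C i l q)%:R - (C i l p)%:R).
Proof.
pose z' j := z j - \sum_i \sum_(l | tight w i l) (z l - z i) * (C i l j)%:R.
suff : z' q = z' p.
  rewrite /z' => e; rewrite (eq_bigr (fun i => (\sum_(l | tight w i l)
    (z l - z i) * (C i l q)%:R) - (\sum_(l | tight w i l)
    (z l - z i) * (C i l p)%:R))); last first.
    by move=> i _; rewrite -sumrB; apply: eq_bigr => l _; rewrite mulrBr.
  by rewrite sumrB; lra.
apply: connected_const (proj2 w_vertex) _ q p => a b tab.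
suff H : \sum_i \sum_(l | tight w i l) (z l - z i) * (C i l b)%:R -
    \sum_i \sum_(l | tight w i l) (z l - z i) * (C i l a)%:R = z b - z a.
  by rewrite /z'; lra.
rewrite -sumrB (bigD1 a)//= -sumrB (bigD1 b)//= -mulrBr cut_arrow// eqxx mulr1.
rewrite big1 ?addr0 => [|l /andP[tal lb]]; last first.
  by rewrite -mulrBr cut_arrow// xpair_eqE eqxx eq_sym (negPf lb) mulr0.
rewrite big1 ?addr0// => i ia; rewrite -sumrB big1// => l til.
by rewrite -mulrBr cut_arrow// xpair_eqE eq_sym (negPf ia) mulr0.
Qed.

Definition cut_value (g : 'I_k -> R) i l := \sum_(j | C i l j) g j.

Lemma cut_dot g z : \sum_j g j = 0 ->
  dot g z = \sum_i \sum_(l | tight w i l) (z l - z i) * cut_value g i l.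
Proof.
case: (posnP k) => [k0 _|k_gt0 g0].
  by rewrite /dot !big1// => -[i ltik]; exfalso; rewrite k0 in ltik.
pose p := Ordinal k_gt0.
have -> : dot g z = \sum_j g j * (z j - z p).
  rewrite (eq_bigr (fun j => g j * z j - g j * z p)) => [|j _]; last exact: mulrBr.
  by rewrite sumrB -mulr_suml g0 mul0r subr0.
under eq_bigr => j _ do rewrite cut_expansion mulr_sumr.
rewrite exchange_big; apply: eq_bigr => i _ /=.
under eq_bigr => j _ do rewrite mulr_sumr.
rewrite exchange_big; apply: eq_bigr => l _ /=.
rewrite (eq_bigr (fun j => (z l - z i) * (g j * (C i l j)%:R) -
   g j * ((z l - z i) * (C i l p)%:R))) => [|j _]; last by ring.
rewrite sumrB -mulr_suml g0 mul0r subr0 -mulr_sumr; congr (_ * _).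
rewrite /cut_value [RHS]big_mkcond; apply: eq_bigr => j _.
by case: (C i l j); rewrite ?mulr1 ?mulr0.
Qed.

(** By [cut_dot], g is a combination with nonnegative coefficients of the
    forms attached to the arrows, each of which is maximal at w. *)
Lemma cut_optimal g u : \sum_j g j = 0 ->
  (forall i l, tight w i l -> 0 <= cut_value g i l) ->
  feasible u -> dot g u <= dot g w.
Proof.
move=> g0 g_ge0 uF; rewrite -subr_ge0 !cut_dot// -sumrB sumr_ge0// => i _.
rewrite -sumrB sumr_ge0// => l til; rewrite -mulrBl mulr_ge0 ?g_ge0//.
by have := tight_le til uF; lra.
Qed.

Definition pivot_by i l t j : R := w j - t * (C i l j)%:R.

Lemma dot_pivot g i l t :
  dot g (pivot_by i l t) = dot g w - t * cut_value g i l.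
Proof.
rewrite /dot /cut_value mulr_sumr [X in _ - X]big_mkcond -sumrB; apply: eq_bigr => j _.
by rewrite /pivot_by; case: (C i l j) => /=; ring.
Qed.

(** Decreasing the coordinates in C i l loosens the arrow (i, l) and keeps the
    other ones; the ratio test stops at a new arrow across the same cut, which
    reconnects the graph. *)
Lemma pivot i l : tight w i l -> exists2 t, 0 < t & vertex (pivot_by i l t).
Proof.
move=> til; have [Cl Ci Cab] := Cw til.
pose s (ab : 'I_k * 'I_k) := c ab.1 ab.2 - (w ab.2 - w ab.1).
pose d (ab : 'I_k * 'I_k) : R := (C i l ab.2)%:R - (C i l ab.1)%:R.
have s_ge0 ab : 0 <= s ab by rewrite subr_ge0; apply: (proj1 w_vertex).
have d_ge0 ab : s ab = 0 -> 0 <= d ab.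
  case: ab => a b; rewrite /s /d /= => s0.
  have [->|ab] := eqVneq a b; first by rewrite subrr.
  rewrite cut_arrow// /tight ab; apply/eqP; lra.
have dneg : exists ab, d ab < 0.
  by exists (l, i); rewrite /d /= Cl (negPf Ci) sub0r oppr_lt0.
have [t t0 [feas [[a b]]]] := ratio_test s_ge0 d_ge0 dneg.
rewrite /s /d /= => dab tab.
have Ca : C i l a by move: dab; case: (C i l a) => //; case: (C i l b) => /=; lra.
have Cb : ~~ C i l b by move: dab; rewrite Ca; case: (C i l b) => //=; lra.
exists t => //; split=> [p q|A Acl].
  by have := feas (p, q); rewrite /s /d /= /pivot_by; lra.
have Ato p q : tight w p q -> (p, q) != (i, l) -> A p = A q.
  move=> tpq pq; apply: Acl; rewrite /tight /pivot_by (Cab _ _ tpq pq).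
  case/andP: tpq => -> /eqP <-; apply/eqP; ring.
have Aab : A a = A b.
  apply: Acl; rewrite /tight; apply/andP; split.
    by apply: contraNneq Cb => <-.
  by rewrite /pivot_by Ca (negPf Cb) in tab *; apply/eqP; lra.
(* If A separates i from l, then A agrees with C i l up to complement, but the
   new arrow (a, b) crosses C i l and not A. *)
have [Ail|Ail] := eqVneq (A i) (A l).
  apply: (proj2 w_vertex) => p q tpq.
  by have [[-> ->]//|pqil] := eqVneq (p, q) (i, l); apply: Ato.
have H : forall p q, tight w p q -> A p (+) C i l p = A q (+) C i l q.
  move=> p q tpq; have [[-> ->]|pqil] := eqVneq (p, q) (i, l).
    by move: Ail; rewrite Cl (negPf Ci); case: (A i); case: (A l).
  by rewrite (Ato _ _ tpq pqil) (Cab _ _ tpq pqil).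
have := proj2 w_vertex _ H a b.
by rewrite Aab Ca (negPf Cb); case: (A b).
Qed.

Lemma pivot_up g u : \sum_j g j = 0 -> feasible u -> dot g w < dot g u ->
  exists i l t, [/\ tight w i l, 0 < t, vertex (pivot_by i l t) &
                    dot g w < dot g (pivot_by i l t)].
Proof.
move=> g0 uF lt_wu.
have [[i [l [til neg]]]|noneg] :=
  pselect (exists i l, tight w i l /\ cut_value g i l < 0).
  have [t t0 tV] := pivot til; exists i, l, t; split=> //.
  by rewrite dot_pivot -subr_gt0 addrC addKr -mulrN mulr_gt0// oppr_gt0.
suff : dot g u <= dot g w by lra.
apply: cut_optimal => // i l til; rewrite leNgt; apply/negP => neg.
by apply: noneg; exists i, l.
Qed.

(** The triangle inequality makes (i, l) an arrow too, or i = l.  In either case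
    one arrow of the resulting cycle is not a bridge. *)
Lemma tight_no_path i j l : (forall i j l, c i l <= c i j + c j l) ->
  tight w i j -> ~~ tight w j l.
Proof.
move=> c_tri tij; apply/negP => tjl.
have [ij jl] : i != j /\ j != l by case/andP: tij => ? _; case/andP: tjl.
have [il|il] := eqVneq i l.
  have [Cj Ci Cab] := Cw tij; move: Ci; rewrite {2}il -(Cab _ _ tjl) ?Cj//.
  by rewrite xpair_eqE eq_sym (negPf ij).
have til : tight w i l.
  rewrite /tight il /=; apply/eqP; have := proj1 w_vertex i l; have := c_tri i j l.
  case/andP: tij => _ /eqP; case/andP: tjl => _ /eqP; lra.
have [Cl + Cab] := Cw til; rewrite (Cab _ _ tij) ?(Cab _ _ tjl) ?Cl//.
  by rewrite xpair_eqE negb_and eq_sym ij.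
by rewrite xpair_eqE negb_and jl orbT.
Qed.

End VertexCuts.

(** The combination of the vectors e_l - e_i with coefficients b i l. *)
Definition flow (b : 'I_k -> 'I_k -> R) j : R :=
  \sum_i \sum_l b i l * ((l == j)%:R - (i == j)%:R).

Lemma dot_flow b z : dot (flow b) z = \sum_i \sum_l b i l * (z l - z i).
Proof.
have delta m : \sum_j (m == j)%:R * z j = z m.
  rewrite (bigD1 m)//= eqxx mul1r big1 ?addr0// => j /negPf jm.
  by rewrite eq_sym jm mul0r.
rewrite /dot /flow; under eq_bigr => j _ do rewrite mulr_suml.
rewrite exchange_big; apply: eq_bigr => i _ /=.
under eq_bigr => j _ do rewrite mulr_suml.
rewrite exchange_big; apply: eq_bigr => l _ /=.
under eq_bigr => j _ do rewrite -mulrA mulrBl.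
by rewrite -mulr_sumr sumrB !delta.
Qed.

Lemma flow_sum b : \sum_j flow b j = 0.
Proof.
have := dot_flow b (fun=> 1); rewrite /dot.
under eq_bigr => j _ do rewrite mulr1.
move=> ->; rewrite big1// => i _; rewrite big1// => l _.
by rewrite subrr mulr0.
Qed.

(** The sum of the forms z l - z i over the arrows (i, l) works. *)
Lemma vertex_exposed w : vertex w -> exists g,
  [/\ \sum_j g j = 0, forall u, feasible u -> dot g u <= dot g w &
      forall u, feasible u -> dot g u = dot g w -> same_point u w].
Proof.
move=> wV; pose g := flow (fun i l => (tight w i l)%:R).
have gE u : dot g w - dot g u =
    \sum_i \sum_(l | tight w i l) ((w l - w i) - (u l - u i)).
  rewrite !dot_flow -sumrB; apply: eq_bigr => i _; rewrite -sumrB.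
  rewrite [RHS]big_mkcond; apply: eq_bigr => l _.
  by case: (tight w i l) => /=; ring.
have t_ge0 u i l : feasible u -> tight w i l -> 0 <= (w l - w i) - (u l - u i).
  by move=> uF til; have := tight_le til uF; lra.
exists g; split=> [|u uF|u uF guw]; first exact: flow_sum.
  rewrite -subr_ge0 gE sumr_ge0// => i _; rewrite sumr_ge0// => l; exact: t_ge0.
have sum0 : \sum_i \sum_(l | tight w i l) ((w l - w i) - (u l - u i)) = 0.
  by rewrite -gE guw subrr.
have u_arrow i l : tight w i l -> u i - w i = u l - w l.
  move=> til; have := psumr_eq0P (fun i _ => sumr_ge0 _ (fun l => t_ge0 u i l uF)) sum0.
  move=> /(_ i isT) /psumr_eq0P /(_ l til) => /(_ (fun l => t_ge0 u i l uF)); lra.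
move=> i j; have := connected_const (proj2 wV) u_arrow i j; lra.
Qed.

(** A vertex with the largest value among the vertices is a maximum, since
    otherwise [pivot_up] would lead to a better vertex. *)
Lemma vertex_maximum g : \sum_j g j = 0 ->
  exists n, forall u, feasible u -> dot g u <= dot g (vtx n).
Proof.
move=> g0; have N_gt0 : (0 < 'C(2 * k - 2, k.-1))%N by rewrite bin_gt0; lia.
case: (@arg_maxP _ _ _ (Ordinal N_gt0) predT (fun n => dot g (vtx n)) isT).
move=> n _ nmax; exists n => u uF; rewrite leNgt; apply/negP => lt_nu.
have [C Cw] := vertex_cuts (vtx_vertex n).
have [i [l [t [_ _ /vtx_surj[m tm]]]]] := pivot_up (vtx_vertex n) Cw g0 uF lt_nu.
by rewrite (dot_same_point g0 tm) ltNge => /negP; apply; apply: nmax.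
Qed.

End Counting.
End Potentials.

(** * Transversal matroids *)

Section Transversal.
Variables (S : finType) (k : nat) (E : 'I_k -> {set S}).
Hypothesis k_gt0 : (0 < k)%N.
Implicit Types A B : {set S}.

Definition transversal_matroid :=
  matroid_union (fun j => uniform_matroid 1 (E j)).
Local Notation M := transversal_matroid.

Definition matches (f : S -> 'I_k) A :=
  {in A &, injective f} /\ {in A, forall a, a \in E (f a)}.

Lemma transversalP A : reflect (exists f, matches f A) (A \in M).
Proof.
apply: (iffP idP) => [|[f [f_inj fE]]].
  rewrite inE => /existsP[J /andP[/forallP J_unif /eqP defA]].
  pose f a := odflt (Ordinal k_gt0) [pick j | a \in J j].
  have fJ a : a \in A -> a \in J (f a).
    rewrite defA => /bigcupP[j _ aJ]; rewrite /f.
    by case: pickP => [//|/(_ j)]; rewrite aJ.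
  exists f; split=> [a b aA bA fab|a aA]; last first.
    by have := J_unif (f a); rewrite inE => /andP[/fintype.subsetP/(_ a (fJ a aA))].
  have := J_unif (f a); rewrite inE => /andP[_ /card_le1_eqP J1].
  by apply: J1; [rewrite fab; apply: fJ|apply: fJ].
rewrite inE; apply/existsP; exists [ffun j => [set a in A | f a == j]%SET].
apply/andP; split.
  apply/forallP => j; rewrite ffunE inE; apply/andP; split.
    by apply/fintype.subsetP => a; rewrite inE => /andP[aA /eqP <-]; apply: fE.
  apply/card_le1_eqP => a b; rewrite !inE => /andP[aA /eqP fa] /andP[bA /eqP fb].
  by apply: f_inj; rewrite ?fa ?fb.
apply/eqP/setP => a; apply/idP/bigcupP => [aA|[j _]].
  by exists (f a); rewrite // ffunE inE aA /=.
by rewrite ffunE inE => /andP[].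
Qed.

Lemma transversal_card A : A \in M -> (#|A| <= k)%N.
Proof.
by move=> /transversalP[f [/card_in_imset <- _]]; rewrite -[leqRHS](card_ord k) max_card.
Qed.

(** Some block index g b is not used by f on A.  If b is outside A, it can be
    added.  Otherwise f is changed to agree with g at b, and the number of
    disagreements of f and g drops. *)
Lemma matches_exchange f g A B :
  matches f A -> matches g B -> (#|A| < #|B|)%N ->
  exists x, [/\ x \in B, x \notin A & (x |: A)%SET \in M].
Proof.
move=> fA [g_inj gE] ltAB.
have [n] := ubnP #|[set b in A | f b != g b]%SET|.
elim: n f fA => // n IH f [f_inj fE] ltn.
have [b bB gb] : exists2 b, b \in B & g b \notin (f @: A)%SET.
  have [/exists_inP//|/exists_inPn sub] := boolP [exists b in B, g b \notin (f @: A)%SET].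
  have : (#|g @: B| <= #|f @: A|)%N.
    apply/subset_leq_card/fintype.subsetP => _ /imsetP[b bB ->].
    exact/negPn/sub.
  by rewrite !card_in_imset// leqNgt ltAB.
pose f' a := if a == b then g b else f a.
have f'E a : a != b -> f' a = f a by rewrite /f' => /negPf->.
have f'b : f' b = g b by rewrite /f' eqxx.
have f'_match : matches f' (b |: A)%SET.
  split=> [x y|x].
    rewrite !inE; have [->|xb] := eqVneq x b; have [->|yb] := eqVneq y b => //=.
    - by move=> _ yA; rewrite f'b f'E// => e; case/imsetP: gb; exists y.
    - by move=> xA _; rewrite f'b f'E// => e; case/imsetP: gb; exists x.
    by move=> xA yA; rewrite !f'E//; apply: f_inj.
  rewrite !inE; have [->|xb] := eqVneq x b => /=; first by rewrite f'b => _; apply: gE.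
  by rewrite f'E//; apply: fE.
have [bA|bA] := boolP (b \in A); last first.
  by exists b; split=> //; apply/transversalP; exists f'.
have bAA : (b |: A)%SET = A by apply/finset.setUidPr; rewrite finset.sub1set.
apply: (IH f'); first by rewrite -bAA.
apply: leq_trans (ltn : (_ <= n)%N); apply: proper_card; apply/properP; split.
  apply/fintype.subsetP => x; rewrite !inE; have [->|xb] := eqVneq x b.
    by rewrite f'b eqxx andbF.
  by rewrite f'E.
exists b; rewrite !inE bA /= ?f'b ?eqxx//.
by apply: contraNneq gb => <-; apply: imset_f.
Qed.

Lemma transversal_is_matroid : is_matroid M.
Proof.
split=> [|A B sAB /transversalP[f [f_inj fE]]|A B].
- exists finset.set0; apply/transversalP; exists (fun=> Ordinal k_gt0).
  by split=> a; rewrite !inE.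
- apply/transversalP; exists f; split=> [x y xA yA|x xA].
    by apply: f_inj; apply: (fintype.subsetP sAB).
  by apply: fE; apply: (fintype.subsetP sAB).
- by move=> /transversalP[f fA] /transversalP[g gB]; apply: matches_exchange fA gB.
Qed.

Lemma transversal_basesP A B : A \in M -> #|A| = k ->
  (B \in bases M) = (B \in M) && (#|B| == k).
Proof.
move=> AM Ak; rewrite inE; apply/maxsetP/andP => [[BM Bmax]|[BM /eqP Bk]].
  split=> //; rewrite eqn_leq transversal_card//= leqNgt -{1}Ak; apply/negP => ltBA.
  have [_ _ /(_ _ _ BM AM ltBA)[x [_ xB xBM]]] := transversal_is_matroid.
  by move: xB; rewrite -(Bmax _ xBM (finset.subsetUr _ _)) setU11.
split=> // D DM sBD; apply/esym/eqP; rewrite eqEcard sBD Bk; exact: transversal_card.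
Qed.
End Transversal.

(** * Affine independence *)

Section Dimension.
Variables (R : realType) (S : finType).
Local Notation V := {ffun S -> R^o}.

(** The two alternatives are the ones met below: more vectors than coordinates,
    or as many vectors as coordinates, all in the hyperplane orthogonal to
    h. *)
Lemma dependent_rows n (p : 'I_n -> V) (h : S -> R) :
  (#|S| < n)%N \/ [/\ (#|S| <= n)%N, exists s, h s != 0 &
                      forall i, \sum_s p i s * h s = 0] ->
  exists2 a : 'I_n -> R, (exists i, a i != 0) & \sum_i a i *: p i = 0.
Proof.
move=> dep; pose A : 'M[R]_(n, #|S|) := \matrix_(i, j) p i (enum_val j).
have rankA : (\rank A < n)%N.
  case: dep => [lt_Sn|[le_Sn [s hs] ph]]; first exact: leq_ltn_trans (rank_leq_col A) lt_Sn.
  pose H : 'cV[R]_#|S| := \col_j h (enum_val j).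
  have AH : A *m H = 0.
    apply/matrixP => i j; rewrite !mxE -[RHS](ph i) [RHS](reindex (@enum_val _ S)) /=.
      by apply: eq_bigr => b _; rewrite !mxE.
    by apply: onW_bij; apply: enum_val_bij.
  have H0 : (0 < \rank H)%N.
    rewrite lt0n mxrank_eq0; apply: contraNneq hs => /matrixP/(_ (enum_rank s) 0).
    by rewrite !mxE enum_rankK => ->.
  apply: leq_trans le_Sn; apply: leq_trans (mulmx0_rank_max AH).
  by rewrite -addn1 leq_add2l.
have : kermx A != 0 by rewrite kermx_eq0 /row_free neq_ltn rankA.
case/rowV0Pn => a /sub_kermxP aA a0; exists (fun i => a 0 i).
  apply: contrapT => none; move/eqP: a0; apply; apply/rowP => i; rewrite mxE.
  by apply: contrapT => ai; apply: none; exists i; apply/eqP.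
apply/ffunP => s; rewrite sum_ffunE ffunE.
have /matrixP/(_ 0 (enum_rank s)) := aA; rewrite !mxE => aA0; rewrite -[RHS]aA0.
by apply: eq_bigr => i _; rewrite !mxE enum_rankK ffunE.
Qed.

(** On a hyperplane of constant nonzero coordinate sum, linear dependence is
    affine dependence. *)
Lemma affinely_dependent n (p : 'I_n -> V) (h : S -> R) (m : R) :
  m != 0 -> (forall i, \sum_s p i s = m) ->
  (#|S| < n)%N \/ [/\ (#|S| <= n)%N, exists s, h s != 0 &
                      forall i, \sum_s p i s * h s = 0] ->
  ~ affinely_independent p.
Proof.
move=> m0 sum_p /dependent_rows[a [i ai] ap] indep; move/eqP: ai; apply.
apply: indep (ap) i; suff : (\sum_i a i) * m = 0.
  by move/eqP; rewrite mulf_eq0 (negPf m0) orbF => /eqP.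
rewrite mulr_suml; transitivity (\sum_s (\sum_i a i *: p i) s); last first.
  by rewrite ap big1// => s _; rewrite ffunE.
under [RHS]eq_bigr => s _ do rewrite sum_ffunE.
rewrite exchange_big; apply: eq_bigr => j _ /=; rewrite -(sum_p j) mulr_sumr.
by apply: eq_bigr => s _; rewrite ffunE.
Qed.

Definition shift_mass (a b : S) : V := [ffun s => (s == a)%:R - (s == b)%:R].

(** The coordinate of such a combination at a point s of Q other than s1 sees
    only the coefficient of s, because no mass is taken from there; the
    coefficient of s1 follows from the sum being zero. *)
Lemma perturbed_independent d (x0 : V) (e : R) (Q : {set S}) (s1 : S)
    (r : S -> S) (cardQ : d.+1 = #|Q|) : e != 0 ->
  (forall s s', s' \in Q -> s' != s1 -> r s != s') ->
  affinely_independent (fun i : 'I_d.+1 =>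
    let s := enum_val (cast_ord cardQ i) in x0 + e *: shift_mass s (r s)).
Proof.
move=> e0 rQ a a0 ap; pose q i := enum_val (cast_ord cardQ i).
have q_inj : injective q.
  by move=> i j /enum_val_inj; apply: cast_ord_inj.
have other i : q i != s1 -> a i = 0.
  move=> qi; have := congr1 (fun x : V => x (q i)) ap.
  rewrite sum_ffunE ffunE (eq_bigr (fun j => a j * x0 (q i) + e * (a j *+ (j == i)))).
    rewrite big_split /= -mulr_suml a0 mul0r add0r -mulr_sumr.
    rewrite (bigD1 i)//= eqxx mulr1n big1 ?addr0 => [|j /negPf->//].
    by move/eqP; rewrite mulf_eq0 (negPf e0) => /eqP.
  move=> j _; rewrite !ffunE /GRing.scale /= -/(q j).
  rewrite [q i == r (q j)]eq_sym (negPf (rQ _ _ (enum_valP _) qi)) (inj_eq q_inj).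
  by rewrite eq_sym; case: (j == i) => /=; ring.
move=> i; have [qi|] := eqVneq (q i) s1; last exact: other.
move: a0; rewrite (bigD1 i)//= big1 ?addr0// => j ji; apply: other.
by rewrite -qi (inj_eq q_inj).
Qed.

End Dimension.

(** * Cells of the hypersimplex *)

Section Cells.
Variables (R : realType) (k : nat) (S : finType) (Sp : 'I_k -> {set S}).
Variable cls : S -> 'I_k.
Hypothesis clsP : forall s i, (s \in Sp i) = (cls s == i).
Local Notation V := {ffun S -> R^o}.
Implicit Types (x y : V) (D : pred 'I_k) (z : 'I_k -> R).

Definition mass x D : R := \sum_(s | D (cls s)) x s.

(** The coefficient y j - 1 of the linear form attached to x. *)
Definition excess x j : R := mass x (pred1 j) - 1.

Lemma mass_partition x D : mass x D = \sum_(j | D j) mass x (pred1 j).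
Proof.
rewrite /mass (exchange_big_dep (fun s => D (cls s))) => [|j s Dj /eqP->//] /=.
apply: eq_bigr => s Ds; rewrite (big_pred1 (cls s)) // => j /=.
have [->|_] := eqVneq j (cls s); first by rewrite Ds.
by rewrite andbF.
Qed.

Lemma sum_excess x D : \sum_(j | D j) excess x j = mass x D - #|D|%:R.
Proof. by rewrite sumrB -mass_partition sumr_const. Qed.

Lemma excess_sum0 x : hypersimplex k x -> \sum_j excess x j = 0.
Proof. by case=> _ sum_x; rewrite sum_excess /mass sum_x card_ord subrr. Qed.

Lemma dot_excess x z :
  dot (excess x) z = \sum_s x s * z (cls s) - \sum_j z j.
Proof.
rewrite /dot; under eq_bigr => j _ do rewrite mulrBl mul1r.
rewrite sumrB; congr (_ - _); under eq_bigr => j _ do rewrite mulr_suml.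
rewrite (exchange_big_dep predT) //=; apply: eq_bigr => s _.
by rewrite (big_pred1 (cls s)) // => j /=; rewrite eq_sym.
Qed.

Lemma mass_linear x y a D : mass (x + a *: y) D = mass x D + a * mass y D.
Proof.
by rewrite /mass mulr_sumr -big_split; apply: eq_bigr => s _; rewrite !ffunE.
Qed.

(** The region where w is optimal for the form attached to x. *)
Definition cell (c : 'I_k -> 'I_k -> R) (w : 'I_k -> R) : set V :=
  [set x | hypersimplex k x /\
           forall u, feasible c u -> dot (excess x) u <= dot (excess x) w].

Lemma convex_between (T : set V) x d t1 t2 : convex_set T -> 0 < t1 -> 0 < t2 ->
  T (x + t1 *: d) -> T (x - t2 *: d) -> T x.
Proof.
move=> Tc t1_gt0 t2_gt0 T1 T2; have t_gt0 : 0 < t1 + t2 by lra.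
have p0 : 0 <= t2 / (t1 + t2) by rewrite divr_ge0; lra.
have p1 : t2 / (t1 + t2) <= 1 by rewrite ler_pdivrMr//; lra.
have := Tc _ _ (Itv01 p0 p1) (mem_set T1) (mem_set T2); rewrite inE.
congr T; apply/ffunP => s; rewrite /conv /= !ffunE /onem /=; rewrite /GRing.scale /=.
by field; lra.
Qed.

(** * Facets and integrality of the cell of a vertex *)
Section VertexCell.
Variables (c : 'I_k -> 'I_k -> R) (w : 'I_k -> R).
Variable C : 'I_k -> 'I_k -> pred 'I_k.
Hypothesis c_tri : forall i j l, c i l <= c i j + c j l.
Hypotheses (w_vertex : vertex c w) (Cw : cut_system c w C).
Local Notation arrow := (tight c w).
Local Notation M := (gammoid Sp arrow).

Definition cut_slack x i l : R := mass x (C i l) - #|C i l|%:R.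

Lemma cut_slackE x i l : cut_slack x i l = cut_value C (excess x) i l.
Proof. by rewrite /cut_value sum_excess. Qed.

(** Testing optimality of w against the endpoint of a pivot gives the
    inequality of the corresponding cut; these inequalities suffice by
    [cut_optimal]. *)
Lemma cellP x : cell c w x <->
  hypersimplex k x /\ forall i l, arrow i l -> 0 <= cut_slack x i l.
Proof.
split=> -[xD xC]; split=> //.
  move=> i l til; have [t t0 [tF _]] := pivot w_vertex Cw til.
  have := xC _ tF; rewrite dot_pivot -cut_slackE -subr_ge0 opprB addrC subrK.
  by rewrite pmulr_rge0.
move=> u uF; apply: (cut_optimal w_vertex Cw) => //; first exact: excess_sum0.
by move=> i l til; rewrite -cut_slackE xC.
Qed.

Lemma dot_excess_cuts x z : hypersimplex k x ->
  dot (excess x) z = \sum_i \sum_(l | arrow i l) (z l - z i) * cut_slack x i l.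
Proof.
move=> /excess_sum0/(cut_dot w_vertex Cw) ->; apply: eq_bigr => i _.
by apply: eq_bigr => l _; rewrite cut_slackE.
Qed.

Lemma mass_shift a b D :
  mass (shift_mass R a b) D = (D (cls a))%:R - (D (cls b))%:R.
Proof.
have delta e : \sum_(s | D (cls s)) (s == e)%:R = (D (cls e))%:R :> R.
  rewrite big_mkcond (bigD1 e)//= eqxx big1 ?addr0; first by case: (D _).
  by move=> s /negPf ->; case: ifP.
by rewrite -!delta -sumrB; apply: eq_bigr => s _; rewrite ffunE.
Qed.

(** All inequalities that define the cell, in one family to which the ratio test
    applies.  Pairs that are not arrows contribute the constant 0. *)
Definition slack x (r : S * bool + 'I_k * 'I_k) : R :=
  match r with
  | inl (s, false) => x s
  | inl (s, true) => 1 - x s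
  | inr (i, l) => if arrow i l then cut_slack x i l else 0
  end.

Lemma cell_slackP x :
  cell c w x <-> (forall r, 0 <= slack x r) /\ \sum_s x s = k%:R.
Proof.
rewrite cellP; split=> [[[x01 sum_x] xC]|[x_ge0 sum_x]].
  split=> // -[[s []]|[i l]] /=; first by have /andP[_] := x01 s; rewrite subr_ge0.
    by have /andP[] := x01 s.
  by case: ifP => // /xC.
split=> [|i l til]; last by have := x_ge0 (inr (i, l)); rewrite /= til.
split=> // s; rewrite (x_ge0 (inl (s, false))) /= -subr_ge0.
exact: (x_ge0 (inl (s, true))).
Qed.

(** The measure that decreases during the rounding of x. *)
Definition loose_count x := #|[pred r | slack x r != 0]|.

Lemma push x a b : cell c w x -> 0 < x a < 1 -> 0 < x b < 1 -> a != b ->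
  (forall i l, arrow i l -> cut_slack x i l = 0 ->
     C i l (cls a) = C i l (cls b)) ->
  exists2 t, 0 < t & cell c w (x + t *: shift_mass R a b) /\
    (loose_count (x + t *: shift_mass R a b)%R < loose_count x)%N.
Proof.
move=> /cell_slackP[x_ge0 sum_x] xa xb ab Cab.
pose d (r : S * bool + 'I_k * 'I_k) : R := match r with
  | inl (s, false) => (s == a)%:R - (s == b)%:R
  | inl (s, true) => (s == b)%:R - (s == a)%:R
  | inr (i, l) => if arrow i l then (C i l (cls a))%:R - (C i l (cls b))%:R else 0
  end.
have slackD t r : slack (x + t *: shift_mass R a b) r = slack x r + t * d r.
  case: r => [[s []]|[i l]] /=; rewrite ?ffunE /=.
  - by rewrite /GRing.scale /=; ring.
  - by [].
  by case: ifP => _; rewrite ?mulr0 ?addr0// /cut_slack mass_linear mass_shift; ring.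
have xab s : s == a \/ s == b -> 0 < x s < 1 by case=> /eqP ->.
have d0 r : slack x r = 0 -> d r = 0.
  case: r => [[s []]|[i l]] /=.
  - case: (boolP (s == a)) (xab s) => [_ /(_ (or_introl isT))|_]; first by lra.
    case: (boolP (s == b)) => [_ /(_ (or_intror isT))|_]; first by lra.
    by rewrite subrr.
  - case: (boolP (s == a)) (xab s) => [_ /(_ (or_introl isT))|_]; first by lra.
    case: (boolP (s == b)) => [_ /(_ (or_intror isT))|_]; first by lra.
    by rewrite subrr.
  by case: ifP => // til /(Cab _ _ til) ->; rewrite subrr.
have [|||t t0 [ge0 [r1 dr1 r1_0]]] := ratio_test (s := slack x) (d := d).
- exact: x_ge0.
- by move=> r /d0 ->.
- by exists (inl (b, false)); rewrite /= eqxx eq_sym (negPf ab) /=; lra.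
exists t => //; split.
  apply/cell_slackP; split=> [r|]; first by rewrite slackD.
  have := mass_linear x (shift_mass R a b) t predT.
  by rewrite mass_shift subrr mulr0 addr0 /mass => ->.
apply: proper_card; apply/properP; split.
  apply/fintype.subsetP => r; rewrite !inE slackD.
  by apply: contraNneq => sr; rewrite sr (d0 _ sr) mulr0 addr0.
exists r1; rewrite !inE ?slackD ?r1_0 ?eqxx//.
by apply: contraTneq dr1 => /d0 ->; rewrite ltxx.
Qed.

(** Let K be the component of the block of s in the graph formed by the arrows
    with positive cut slack.  Expanding the indicator of K in cuts, only
    arrows with vanishing slack contribute, so x has mass exactly |K| on K.
    As this is an integer, s cannot be the only fractional coordinate over
    K.  No tight cut separates two nodes of K. *)
Lemma fractional_pair x s : cell c w x -> x s != 0 -> x s != 1 ->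
  exists s', [/\ s' != s, x s' != 0, x s' != 1 &
    forall i l, arrow i l -> cut_slack x i l = 0 ->
      C i l (cls s) = C i l (cls s')].
Proof.
move=> xcell xs0 xs1; have [xD xC] := xcell; have [x01 _] := xD.
pose e := [rel p q | (arrow p q && (cut_slack x p q != 0)) ||
                     (arrow q p && (cut_slack x q p != 0))].
pose K : pred 'I_k := [pred j | connect e (cls s) j].
have Ke p q : e p q -> K p = K q.
  move=> epq; apply/idP/idP => H; apply: connect_trans H (connect1 _) => //.
  by move: epq; rewrite /= orbC.
have massK : mass x K = #|K|%:R.
  have := dot_excess_cuts (fun j => (K j)%:R) xD.
  rewrite big1 => [|i _]; last first.
    rewrite big1// => l til; have [->|n0] := eqVneq (cut_slack x i l) 0.
      by rewrite mulr0.
    by rewrite (Ke i l) ?subrr ?mul0r//= til n0.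
  rewrite /dot (eq_bigr (fun j => if K j then excess x j else 0)); last first.
    by move=> j _; case: (K j); rewrite ?mulr1 ?mulr0.
  by rewrite -big_mkcond sum_excess; lra.
have [s' /= /and4P[Ks' s's xs'0 xs'1]|none] := pickP
    (fun s' => [&& K (cls s'), s' != s, x s' != 0 & x s' != 1]).
  exists s'; split=> // i l til sl0; have [_ _ Cab] := Cw til.
  have Ce p q : e p q -> C i l p = C i l q.
    case/orP=> /andP[tpq npq]; [|symmetry]; apply: Cab => //;
      by apply: contraNneq npq => -[-> ->]; rewrite sl0.
  case/connectP: Ks' => p; elim: p (cls s) => [|q p IH] j /= => [_ ->//|].
  by case/andP=> /Ce -> ejp; apply: IH.
have Ks : K (cls s) by apply: connect0.
pose m := (\sum_(s' | K (cls s') && (s' != s)) (x s' == 1%R))%N.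
have : x s + m%:R = #|K|%:R.
  rewrite -massK /mass (bigD1 s)//=; congr (_ + _).
  rewrite /m natr_sum; apply: eq_bigr => s' /andP[Ks' s's].
  have := none s'; rewrite Ks' s's /=; case: eqVneq => [->|_] /=.
    by rewrite eq_sym oner_eq0.
  by case: eqVneq => [->|].
have /andP[xs_ge0 xs_le1] := x01 s.
have {}xs0 : 0 < x s by rewrite lt_def xs0.
have {}xs1 : x s < 1 by rewrite lt_def eq_sym xs1.
move=> eqK; have : (m < #|K| < m.+1)%N.
  by rewrite -!(ltr_nat R) -eqK -natr1; lra.
by lia.
Qed.

(** A point with a fractional coordinate lies between the two points reached by
    pushing mass back and forth along a fractional pair, and these have fewer
    positive slacks. *)
Lemma cell_integral_hull (T : set V) : convex_set T ->
  (forall x, cell c w x -> (forall s, x s = 0 \/ x s = 1) -> T x) ->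
  cell c w `<=` T.
Proof.
move=> Tc Tint x; have [n] := ubnP (loose_count x).
elim: n x => // n IH x ltn xcell.
have [s /= /andP[xs0 xs1]|int] := pickP (fun s => (x s != 0) && (x s != 1)); last first.
  apply: Tint => // s; have := int s.
  by have [->|_] := eqVneq (x s) 0; [left|have [->|//] := eqVneq (x s) 1; right].
have [s' [s's xs'0 xs'1 Css']] := fractional_pair xcell xs0 xs1.
have frac p : x p != 0 -> x p != 1 -> 0 < x p < 1.
  have /andP[p0 p1] := (proj1 (proj1 xcell)) p.
  by rewrite !lt_def p0 p1 => -> /=; rewrite eq_sym => ->.
have fs := frac _ xs0 xs1; have fs' := frac _ xs'0 xs'1.
have [|t1 t1_gt0 [cell1 lt1]] := push xcell fs fs' _ Css'; first by rewrite eq_sym.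
have [|t2 t2_gt0 [cell2 lt2]] := push xcell fs' fs s's.
  by move=> i l til sl0; rewrite Css'.
apply: (convex_between (d := shift_mass R s s') (t1 := t1) (t2 := t2)) => //.
  by apply: IH => //; apply: leq_trans lt1 ltn.
have -> : x - t2 *: shift_mass R s s' = x + t2 *: shift_mass R s' s.
  by apply/ffunP => p; rewrite !ffunE /GRing.scale /=; ring.
by apply: IH => //; apply: leq_trans lt2 ltn.
Qed.

(** * Bases as integral points *)
Hypothesis k_gt0 : (0 < k)%N.
Hypothesis Sp_gt0 : forall i, (0 < #|Sp i|)%N.

Lemma gammoid_rank : exists2 A, A \in M & #|A| = k.
Proof.
have pick_Sp i : {s | s \in Sp i}.
  by apply: sigW; have /card_gt0P := Sp_gt0 i.
pose h i := sval (pick_Sp i).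
have cls_h i : cls (h i) = i by apply/eqP; rewrite -clsP /h; case: (pick_Sp i).
exists (h @: [set: 'I_k])%SET; last first.
  by rewrite card_imset ?cardsT ?card_ord//; apply: can_inj cls_h.
apply/(transversalP _ k_gt0); exists cls; split=> [a b|a] /imsetP[i _ ->].
  by case/imsetP => j _ ->; rewrite !cls_h => ->.
by apply/bigcupP; exists (cls (h i)); rewrite ?eqxx// clsP.
Qed.

Lemma gammoid_basesP (B : {set S}) : (B \in bases M) = (B \in M) && (#|B| == k).
Proof. by have [A AM Ak] := gammoid_rank; apply: transversal_basesP AM Ak. Qed.

Lemma sum_indicator (B : {set S}) (h : S -> R) :
  \sum_s indicator R B s * h s = \sum_(s in B) h s.
Proof.
rewrite [RHS]big_mkcond; apply: eq_bigr => s _; rewrite ffunE.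
by case: (s \in B); rewrite ?mul1r ?mul0r.
Qed.

Lemma sum_indicator1 (B : {set S}) : \sum_s indicator R B s = #|B|%:R.
Proof.
rewrite -sumr_const -(sum_indicator B (fun=> 1)).
by apply: eq_bigr => s _; rewrite mulr1.
Qed.

Lemma indicator_hypersimplex (B : {set S}) :
  #|B| = k -> hypersimplex k (indicator R B).
Proof.
move=> Bk; split=> [s|]; last by rewrite sum_indicator1 Bk.
by rewrite ffunE; case: (s \in B); rewrite ?ler01 ?lexx.
Qed.

(** A matching f of B onto the blocks writes the form attached to B as the sum
    of the forms z (cls s) - z (f s) over s in B, each of which vanishes
    identically or is the form of an arrow. *)
Lemma basis_cell (B : {set S}) : B \in bases M -> cell c w (indicator R B).
Proof.
rewrite gammoid_basesP => /andP[/(transversalP _ k_gt0)[f [f_inj fE]] /eqP Bk].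
split=> [|u uF]; first exact: indicator_hypersimplex.
rewrite !dot_excess !sum_indicator.
have fB : (f @: B)%SET = [set: 'I_k]%SET.
  by apply/eqP; rewrite eqEcard finset.subsetT cardsT card_ord card_in_imset// Bk leqnn.
have imB z : \sum_(s in B) z (f s) = \sum_j z j.
  rewrite -(big_imset z f_inj) fB; apply: eq_bigl => j; exact: finset.in_setT.
have : \sum_(s in B) (w (f s) - u (f s)) <= \sum_(s in B) (w (cls s) - u (cls s)).
  apply: ler_sum => s sB; have /bigcupP[l] := fE s sB.
  rewrite clsP => /orP[/eqP->|tl] /eqP ->; first by [].
  by have := tight_le tl uF; lra.
by rewrite !sumrB !imB; lra.
Qed.

(** A bipartite matching between blocks and elements of B, remembering only the
    block t j of the element matched to j. *)
Definition routes (B : {set S}) (t : 'I_k -> 'I_k) :=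
  (forall j, t j = j \/ arrow j (t j)) /\
  forall l, #|[pred j | t j == l]| = #|[pred s in B | cls s == l]|.

(** Over each block l, match the nodes routed to l with the elements of B in
    S_l, both taken in the order of their enumeration. *)
Lemma routes_independent (B : {set S}) t : routes B t -> B \in M.
Proof.
move=> [t_arrow t_card].
pose part l := enum [pred s in B | cls s == l].
pose fibre l := enum [pred j | t j == l].
pose f s := nth (Ordinal k_gt0) (fibre (cls s)) (index s (part (cls s))).
have in_part s : s \in B -> s \in part (cls s).
  by move=> sB; rewrite mem_enum !inE sB eqxx.
have idx s : s \in B -> (index s (part (cls s)) < size (fibre (cls s)))%N.
  by move=> sB; rewrite -cardE t_card cardE index_mem in_part.
have tf s : s \in B -> t (f s) = cls s.
  move=> sB; apply/eqP; have : f s \in fibre (cls s) by rewrite mem_nth// idx.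
  by rewrite mem_enum inE.
apply/(transversalP _ k_gt0); exists f; split=> [a b aB bB fab|a aB].
  have cab : cls a = cls b by rewrite -!tf// fab.
  have := fab; rewrite /f cab => /eqP; rewrite nth_uniq ?enum_uniq ?idx//; last first.
    by rewrite -cab idx.
  move=> /eqP /(congr1 (nth a (part (cls b)))).
  by rewrite !nth_index// ?in_part// -cab in_part.
apply/bigcupP; exists (cls a); last by rewrite clsP.
by rewrite -(tf a aB); case: (t_arrow (f a)) => [->|->]; rewrite ?eqxx ?orbT.
Qed.

(** The slack m i l of the cut of (i, l) is the number of units that have to be
    moved along this arrow for every block to receive one element of B.  Since
    arrows do not compose, a source with mass y i has y i + (outgoing units)
    = 1, so it sends at most one unit; route it along the arrow that carries
    this unit. *)
Lemma integral_cell_basis (B : {set S}) :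
  cell c w (indicator R B) -> B \in bases M.
Proof.
move=> Bcell; have [BD slack_ge0] := proj1 (cellP _) Bcell.
have massB D : mass (indicator R B) D = #|[pred s in B | D (cls s)]|%:R.
  rewrite /mass big_mkcond /= -sum1_card natr_sum [RHS]big_mkcond /=.
  apply: eq_bigr => s _; rewrite ffunE inE /=.
  by case: (s \in B); case: (D (cls s)).
rewrite gammoid_basesP; apply/andP; split; last first.
  by case: BD => _; rewrite sum_indicator1 => /eqP; rewrite eqr_nat.
pose m i l := (#|[pred s in B | C i l (cls s)]| - #|C i l|)%N.
pose y (l : 'I_k) := #|[pred s in B | cls s == l]|.
have mE i l : arrow i l -> cut_slack (indicator R B) i l = (m i l)%:R.
  move=> til; have := slack_ge0 i l til; rewrite /cut_slack massB subr_ge0 ler_nat.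
  by move=> le; rewrite natrB.
have balance l : (y l + \sum_(h | arrow l h) m l h = 1 + \sum_(i | arrow i l) m i l)%N.
  have := dot_excess_cuts (fun j => (j == l)%:R) BD.
  rewrite /dot (bigD1 l)//= eqxx mulr1 big1 => [|j /negPf ->]; last by rewrite mulr0.
  rewrite addr0 /excess massB => e; apply/eqP; rewrite -(eqr_nat R) !natrD !natr_sum.
  suff : \sum_i \sum_(h | arrow i h)
      ((h == l)%:R - (i == l)%:R) * cut_slack (indicator R B) i h =
    \sum_(i | arrow i l) (m i l)%:R - \sum_(h | arrow l h) (m l h)%:R.
    by rewrite -e /y => e2; apply/eqP; move: e2; rewrite [#|_|](_ : _ = y l)//; lra.
  rewrite (eq_bigr (fun i => (if arrow i l then (m i l)%:R else 0) -
    (if i == l then \sum_(h | arrow l h) (m l h)%:R else 0))).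
    by rewrite sumrB -!big_mkcond big_pred1_eq.
  move=> i _; under eq_bigr => h til do rewrite mE// mulrBl.
  rewrite sumrB; congr (_ - _).
    rewrite big_mkcond (bigD1 l)//= eqxx mul1r big1 ?addr0// => h /negPf ->.
    by rewrite mul0r; case: ifP.
  case: eqVneq => [->|_]; last by rewrite big1// => h _; rewrite mul0r.
  by apply: eq_bigr => h _; rewrite mul1r.
have out_le1 j : (\sum_(h | arrow j h) m j h <= 1)%N.
  have [h tjh|none] := pickP (arrow j); last by rewrite big_pred0.
  have := balance j; rewrite [X in (1 + X)%N]big_pred0 => [|i]; first by lia.
  apply/negP => tij.
  by have := tight_no_path w_vertex Cw h c_tri tij; rewrite tjh.
pose t j := odflt j [pick h | arrow j h && (m j h != 0%N)].
have tE j l : ((t j == l) = (j == l) * (1 - \sum_(h | arrow j h) m j h) +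
                (if arrow j l then m j l else 0) :> nat)%N.
  have := out_le1 j; rewrite /t; case: pickP => [h /andP[tjh mjh]|none] /=.
    rewrite (bigD1 h)//=; set r := (\sum_(i | _) _)%N => le1.
    have mjh1 : m j h = 1%N by move: le1 mjh; rewrite -lt0n; lia.
    have rest : r = 0%N by move: le1 mjh; rewrite -lt0n; lia.
    rewrite rest mjh1 muln0 add0n; case: (eqVneq h l) => [<-|hl]; first by rewrite tjh mjh1.
    case: ifP => // tjl; move/eqP: rest; rewrite sum_nat_eq0 => /forall_inP/(_ l).
    by rewrite tjl eq_sym hl => /(_ isT)/eqP ->.
  move=> _; have m0 h : arrow j h -> m j h = 0%N.
    by move=> tjh; have := none h; rewrite tjh /= => /negbFE/eqP.
  rewrite big1// muln1; case: ifP => [/m0 ->|_]; by rewrite addn0.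
apply: (routes_independent (t := t)); split=> [j|l].
  rewrite /t; case: pickP => [h /andP[tjh _]|_]; by [right|left].
rewrite -sum1_card big_mkcond /= (eq_bigr (fun j =>
  ((j == l) * (1 - \sum_(h | arrow j h) m j h) +
                (if arrow j l then m j l else 0))%N)); last first.
  by move=> j _; rewrite -tE inE; case: (t j == l).
rewrite big_split /= -big_mkcond /= (bigD1 l)//= eqxx mul1n.
rewrite [X in (_ + X + _)%N]big1 ?addn0 => [|j /negPf ->//].
move: (balance l) (out_le1 l); rewrite -/(y l).
by move: (\sum_(h | arrow l h) _)%N (\sum_(i | arrow i l) _)%N => X Y; lia.
Qed.

Lemma convex_cell : convex_set (cell c w).
Proof.
move=> x y p; rewrite !inE => -[[x01 sum_x] xC] [[y01 sum_y] yC].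
have p0 : 0 <= p%:num by []. have p1 : p%:num <= 1 by [].
have combE (h : S -> R) : \sum_s conv p x y s * h s =
    p%:num * (\sum_s x s * h s) + (1 - p%:num) * (\sum_s y s * h s).
  rewrite !mulr_sumr -big_split; apply: eq_bigr => s _.
  by rewrite /conv /= !ffunE /GRing.scale /= /onem; ring.
split; first split.
- move=> s; rewrite /conv /= !ffunE /GRing.scale /= /onem.
  have := x01 s; have := y01 s; nra.
- have := combE (fun=> 1); rewrite -!mulr_suml !mulr1 sum_x sum_y => ->; ring.
move=> u uF; have := xC u uF; have := yC u uF.
rewrite !dot_excess !combE; nra.
Qed.

Lemma base_polytope_cell : base_polytope (R := R) M = cell c w.
Proof.
apply/seteqP; split.
  apply: smallest_sub; first exact: convex_cell.
  by move=> _ [B BM <-]; apply: basis_cell.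
move=> x xcell T [Tc sub]; apply: cell_integral_hull Tc _ _ xcell => y ycell y01.
pose B := [set s | y s == 1]%SET.
have yB : y = indicator R B.
  apply/ffunP => s; rewrite ffunE inE; case: (y01 s) => ->; rewrite ?eqxx//.
  by rewrite eq_sym oner_eq0.
rewrite yB; apply: sub; exists B => //=; apply: integral_cell_basis.
by rewrite -yB.
Qed.

(** * Dimensions of cells and of their facets *)
Hypothesis Sp_ge2 : forall i, (2 <= #|Sp i|)%N.

Lemma mass_const (h : 'I_k -> R) D :
  mass [ffun s => h (cls s) / #|Sp (cls s)|%:R] D = \sum_(j | D j) h j.
Proof.
rewrite mass_partition; apply: eq_bigr => j _; rewrite /mass.
rewrite (eq_bigr (fun=> h j / #|Sp j|%:R)) => [|s /eqP <-]; last by rewrite ffunE.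
rewrite sumr_const -[LHS]mulr_natr (_ : #|_| = #|Sp j|); last first.
  by apply: eq_card => s; rewrite clsP.
by rewrite divfK// pnatr_eq0 -lt0n Sp_gt0.
Qed.

(** Perturb the mass 1 on every block by the flow with the small value b0 on the
    arrows of E.  By duality of arrows and cuts the slack of a cut is the value
    of the flow on its arrow.  Blocks have at least two elements and mass less
    than 2, so spreading the mass evenly keeps all coordinates below 1. *)
Lemma interior_point (E : rel 'I_k) : exists x0 e, [/\ 0 < e, cell c w x0,
    forall s, e <= x0 s <= 1 - e &
    forall i l, arrow i l -> if E i l then is_true (e <= cut_slack x0 i l)
                                      else cut_slack x0 i l = 0].
Proof.
(* At most k arrows enter a node and at most k leave it, so the flow changes
   a mass by less than 1. *)
pose b0 : R := k.+1%:R^-1.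
have b0_gt0 : 0 < b0 by rewrite invr_gt0 ltr0n.
have kb0 : k%:R * b0 < 1.
  by rewrite -[ltRHS](mulVf (_ : k.+1%:R != 0)) ?pnatr_eq0// mulrC ltr_pM2l// ltr_nat.
pose b i l := if arrow i l && E i l then b0 else 0.
have b_ge0 i l : 0 <= b i l by rewrite /b; case: ifP => // _; exact: ltW.
have b_le i l : b i l <= b0 by rewrite /b; case: ifP => // _; exact: ltW.
have flowE j : flow b j = \sum_i b i j - \sum_l b j l.
  rewrite /flow (eq_bigr (fun i => b i j - (if i == j then \sum_l b j l else 0))).
    by rewrite sumrB -[X in _ - X]big_mkcond big_pred1_eq.
  move=> i _; under eq_bigr => l _ do rewrite mulrBr.
  rewrite sumrB; congr (_ - _).
    rewrite (bigD1 j)//= eqxx mulr1 big1 ?addr0// => l /negPf ->.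
    by rewrite mulr0.
  case: eqVneq => [->|_]; last by rewrite big1// => l _; rewrite mulr0.
  by apply: eq_bigr => l _; rewrite mulr1.
have sum_le (h : 'I_k -> R) : (forall i, h i <= b0) -> \sum_i h i <= k%:R * b0.
  move=> hb; apply: le_trans (ler_sum _ (fun i _ => hb i)) _.
  by rewrite sumr_const card_ord -[leLHS]mulr_natr mulrC.
have flow_lt1 j : -1 < flow b j < 1.
  rewrite flowE.
  have := sum_le (b ^~ j) (fun i => b_le i j); have := sum_le (b j) (b_le j).
  have : 0 <= \sum_i b i j by apply: sumr_ge0.
  have : 0 <= \sum_l b j l by apply: sumr_ge0.
  lra.
pose x0 : V := [ffun s => (1 + flow b (cls s)) / #|Sp (cls s)|%:R].
have massx0 D : mass x0 D = #|D|%:R + \sum_(j | D j) flow b j.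
  by rewrite (mass_const (fun j => 1 + flow b j)) big_split /= sumr_const.
have x0_gt0 s : 0 < x0 s.
  rewrite ffunE divr_gt0 ?ltr0n//; have := flow_lt1 (cls s); lra.
have x0_lt1 s : x0 s < 1.
  rewrite ffunE ltr_pdivrMr ?ltr0n// mul1r.
  have : (2%:R : R) <= #|Sp (cls s)|%:R by rewrite ler_nat.
  have := flow_lt1 (cls s); lra.
have slackx0 i l : arrow i l -> cut_slack x0 i l = b i l.
  move=> til; rewrite /cut_slack massx0 addrC addKr.
  have -> : \sum_(j | C i l j) flow b j = dot (flow b) (fun j => (C i l j)%:R).
    rewrite /dot big_mkcond; apply: eq_bigr => j _.
    by case: (C i l j); rewrite ?mulr1 ?mulr0.
  rewrite dot_flow (eq_bigr (fun p => \sum_q b p q * ((p, q) == (i, l))%:R)); last first.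
    move=> p _; apply: eq_bigr => q _; rewrite /b.
    by case: ifP => [/andP[tpq _]|_]; rewrite ?mul0r// (cut_arrow Cw til tpq).
  rewrite (bigD1 i)//= (bigD1 l)//= eqxx mulr1 big1 => [|q /negPf ql]; last first.
    by rewrite xpair_eqE ql andbF mulr0.
  rewrite big1 ?addr0// => p /negPf pi; rewrite big1// => q _.
  by rewrite xpair_eqE pi mulr0.
have [e1 e1_gt0 e1x] := finite_margin x0_gt0.
have [|e2 e2_gt0 e2x] := finite_margin (s := fun s => 1 - x0 s).
  by move=> s; rewrite subr_gt0.
pose e := Num.min b0 (Num.min e1 e2).
have e_gt0 : 0 < e by rewrite !lt_min b0_gt0 e1_gt0.
have eb : e <= b0 by rewrite ge_min lexx.
have ee1 : e <= e1 by rewrite !ge_min lexx orbT.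
have ee2 : e <= e2 by rewrite !ge_min lexx !orbT.
exists x0, e; split=> // [|s|i l til]; last first.
- by have := slackx0 i l til; rewrite /b til; case: (E i l) => ->.
- have := e1x s; have := e2x s; lra.
apply/cellP; split=> [|i l til]; last by rewrite slackx0.
split=> [s|]; first by rewrite !ltW.
have := massx0 predT; rewrite /mass flow_sum addr0 => ->.
by rewrite (card_ord k).
Qed.

(** Around the interior point, mass may be moved freely from r s to s as long as
    the cuts of the arrows outside E are not crossed. *)
Lemma has_dim_perturb (E : rel 'I_k) d (Q : {set S}) (s1 : S) (r : S -> S) :
  d.+1 = #|Q| -> (forall s s', s' \in Q -> s' != s1 -> r s != s') ->
  (forall i l s, arrow i l -> ~~ E i l -> C i l (cls s) = C i l (cls (r s))) ->
  exists2 p : 'I_d.+1 -> V, forall i, cell c w (p i) /\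
      (forall a b, arrow a b -> ~~ E a b -> cut_slack (p i) a b = 0) &
    affinely_independent p.
Proof.
move=> cardQ rQ rC; have [x0 [e [e_gt0 x0cell x0e x0E]]] := interior_point E.
exists (fun i : 'I_d.+1 => let s := enum_val (cast_ord cardQ i) in
    x0 + e *: shift_mass R s (r s)); last first.
  by apply: perturbed_independent rQ; rewrite gt_eqF.
move=> i /=; set s := enum_val _.
have slackE a b : cut_slack (x0 + e *: shift_mass R s (r s)) a b =
    cut_slack x0 a b + e * ((C a b (cls s))%:R - (C a b (cls (r s)))%:R).
  by rewrite /cut_slack mass_linear mass_shift; ring.
split=> [|a b tab Eab]; last first.
  have := x0E a b tab; rewrite (negPf Eab) slackE => ->.
  by rewrite (rC _ _ s tab Eab) subrr mulr0 addr0.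
apply/cell_slackP; split=> [[[s' []]|[a b]] /=|].
- have := x0e s'; rewrite !ffunE /GRing.scale /=.
  by case: (s' == s); case: (s' == r s) => /=; lra.
- have := x0e s'; rewrite !ffunE /GRing.scale /=.
  by case: (s' == s); case: (s' == r s) => /=; lra.
- case: ifP => // tab; have := x0E a b tab; rewrite slackE; case: ifP => [_|Eab].
    by case: (C a b (cls s)); case: (C a b (cls (r s))) => /=; lra.
  by rewrite (rC _ _ s tab) ?Eab// => ->; rewrite subrr mulr0 addr0.
have := mass_linear x0 (shift_mass R s (r s)) e predT.
rewrite mass_shift subrr mulr0 addr0 /mass => ->.
exact: (proj2 (proj1 x0cell)).
Qed.

Lemma card_S_gt0 : (0 < #|S|)%N.
Proof. exact: leq_trans (Sp_gt0 (Ordinal k_gt0)) (max_card _). Qed.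

Lemma cell_dim : has_dim (cell c w) #|S|.-1.
Proof.
have S_gt0 := card_S_gt0.
have [s1 _] : exists s, s \in Sp (Ordinal k_gt0) by apply/card_gt0P.
split.
  have [|||p pP p_ind] := @has_dim_perturb (fun _ _ => true) #|S|.-1
    [set: S]%SET s1 (fun=> s1).
  - by rewrite cardsT prednK.
  - by move=> _ s' _; rewrite eq_sym.
  - by [].
  by exists p => // i; have [] := pP i.
move=> p pcell; apply: (affinely_dependent (h := fun=> 0) (m := k%:R)).
- by rewrite pnatr_eq0 -lt0n.
- by move=> i; have [[_ ->]] := pcell i.
- by left; rewrite prednK.
Qed.

(** Mass is moved towards s from one fixed element on the same side of the cut:
    s1 inside it and s2 outside.  The second hyperplane containing the facet is
    written homogeneously as x(C i0 l0) = (|C i0 l0| / k) x(S). *)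
Lemma facet_dim i0 l0 : arrow i0 l0 ->
  has_dim (cell c w `&` [set x | cut_slack x i0 l0 = 0]) #|S|.-2.
Proof.
move=> til; have [Cl Ci Cab] := Cw til.
have [s1 s1l] : exists s, s \in Sp l0 by apply/card_gt0P.
have [s2 s2i] : exists s, s \in Sp i0 by apply/card_gt0P.
rewrite clsP in s1l; rewrite clsP in s2i; move/eqP: s1l => s1l; move/eqP: s2i => s2i.
have S_ge2 : (1 < #|S|)%N by apply: leq_trans (Sp_ge2 i0) (max_card _).
split.
  pose r s := if C i0 l0 (cls s) then s1 else s2.
  have [|||p pP p_ind] := @has_dim_perturb (fun a b => (a, b) != (i0, l0))
     #|S|.-2 ([set: S] :\ s2)%SET s1 r.
  - have := cardsD1 s2 [set: S]; rewrite inE cardsT; lia.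
  - move=> s s'; rewrite !inE andbT => s's2 s's1.
    by rewrite /r; case: ifP => _; rewrite eq_sym.
  - move=> a b s tab /negPn/eqP[-> ->]; rewrite /r; case: ifP => Cs.
      by rewrite s1l Cl.
    by rewrite s2i (negPf Ci).
  exists p => // i; have [pc p0] := pP i; split=> //.
  by apply: p0 => //; rewrite negbK.
move=> p pcell; apply: (affinely_dependent (m := k%:R)
  (h := fun s => (C i0 l0 (cls s))%:R - #|C i0 l0|%:R / k%:R)).
- by rewrite pnatr_eq0 -lt0n.
- by move=> i; have [[[_ ->]]] := pcell i.
have k0 : k%:R != 0 :> R by rewrite pnatr_eq0 -lt0n.
right; split; first by lia.
- exists s1; rewrite s1l Cl subr_eq0 eq_sym; apply/eqP => e.
  have : #|C i0 l0|%:R = k%:R :> R by rewrite -[LHS](divfK k0) e mul1r.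
  move/eqP; rewrite eqr_nat => /eqP cardC.
  have : (#|C i0 l0| < #|'I_k|)%N.
    by apply: proper_card; apply/properP; split; [apply/fintype.subsetP|exists i0].
  by rewrite cardC card_ord ltnn.
move=> i; have [[[_ sum_p] _] slack0] := pcell i.
under eq_bigr => s _ do rewrite mulrBr.
rewrite sumrB -mulr_suml sum_p mulrC divfK// -[RHS]slack0.
congr (_ - _); rewrite /mass [RHS]big_mkcond.
by apply: eq_bigr => s _; case: (C _ _ _); rewrite ?mulr1 ?mulr0.
Qed.

(** The values of the form of x at w and at the pivot differ by t times the slack
    of the cut. *)
Lemma cell_pivot i l t :
  arrow i l -> t != 0 -> feasible c (pivot_by w C i l t) ->
  cell c w `&` cell c (pivot_by w C i l t) =
  cell c w `&` [set x | cut_slack x i l = 0].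
Proof.
move=> til t0 pF; apply/seteqP; split=> x [xw].
  move=> [_ /(_ w (proj1 w_vertex))]; have := proj2 xw _ pF.
  rewrite dot_pivot -cut_slackE => le1 le2; split=> //=; apply/eqP.
  rewrite -(mulrI_eq0 _ (mulfI t0)); apply/eqP; lra.
move=> /= slack0; split=> //; split; first by case: xw.
by rewrite dot_pivot -cut_slackE slack0 mulr0 subr0; case: xw.
Qed.

End VertexCell.
End Cells.

(** * The subdivision by cells *)

Section Subdivision.
Variables (R : realType) (k : nat) (S : finType) (Sp : 'I_k -> {set S}).
Variables (cls : S -> 'I_k) (c : 'I_k -> 'I_k -> R).
Variable vtx : 'I_('C(2 * k - 2, k.-1)) -> 'I_k -> R.
Hypothesis k_gt0 : (0 < k)%N.
Hypothesis clsP : forall s i, (s \in Sp i) = (cls s == i).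
Hypothesis Sp_ge2 : forall i, (2 <= #|Sp i|)%N.
Hypothesis c_tri : forall i j l, c i l <= c i j + c j l.
Hypothesis vtx_vertex : forall n, vertex c (vtx n).
Hypothesis vtx_inj : forall m n, same_point (vtx m) (vtx n) -> m = n.
Hypothesis vtx_surj : forall w, vertex c w -> exists n, same_point w (vtx n).
Local Notation V := {ffun S -> R^o}.
Local Notation cell := (cell cls c).

Let Sp_gt0 i : (0 < #|Sp i|)%N. Proof. exact: ltnW. Qed.

Let cuts w (wV : vertex c w) : exists C, cut_system c w C.
Proof. exact: (vertex_cuts vtx_vertex vtx_inj vtx_surj wV). Qed.

Definition cells : set (set V) := [set cell w | w in vertex c].

Lemma cell_gammoid w : vertex c w ->
  base_polytope (R := R) (gammoid Sp (tight c w)) = cell w.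
Proof.
by move=> wV; have [C Cw] := cuts wV; apply: (base_polytope_cell clsP c_tri wV Cw).
Qed.

Lemma cell_same_point u w : same_point u w -> cell u = cell w.
Proof.
move=> uw; apply/seteqP; split=> x [xD xC]; split=> // z /xC;
  by rewrite (dot_same_point (excess_sum0 cls xD) uw).
Qed.

Definition pairing (h : S -> R) (x : V) : R^o := \sum_s x s * h s.

Fact pairing_linear h : linear (pairing h).
Proof.
move=> a x y; rewrite /pairing scaler_sumr -big_split; apply: eq_bigr => s _.
by rewrite !ffunE /GRing.scale /=; ring.
Qed.
HB.instance Definition _ h :=
  GRing.isLinear.Build R V R^o *:%R (pairing h) (pairing_linear h).

(** The form attached to x is affine in x, and so is the comparison of its values
    at w and at w'. *)
Lemma cell_face w w' : feasible c w -> feasible c w' ->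
  is_face (cell w) (cell w `&` cell w').
Proof.
move=> wF w'F.
exists (pairing (fun s => w' (cls s) - w (cls s)) : {linear V -> R^o}).
exists (\sum_j w' j - \sum_j w j).
have pairE x : pairing (fun s => w' (cls s) - w (cls s)) x -
    (\sum_j w' j - \sum_j w j) = dot (excess cls x) w' - dot (excess cls x) w.
  rewrite !dot_excess /pairing; under eq_bigr => s _ do rewrite mulrBr.
  by rewrite sumrB; ring.
split=> [x [_ /(_ w' w'F)]|]; first by have := pairE x => /=; lra.
apply/seteqP; split=> x [xw] => [[_ /(_ w wF) le1]|/= eq0]; split=> //.
  have := proj2 xw _ w'F; have := pairE x => /= e le2; lra.
split; first exact: (proj1 xw).
move=> u uF; have := proj2 xw u uF; have := pairE x => /= e le; lra.
Qed.

Lemma cells_cover x : hypersimplex k x -> exists2 w, vertex c w & cell w x.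
Proof.
move=> xD; have [n nmax] := vertex_maximum vtx_vertex vtx_inj vtx_surj
  (excess_sum0 cls xD).
by exists (vtx n).
Qed.

(** The chains that [connected_in_codim1] asks for. *)
Definition chained (d : nat) (Sigma : set (set V)) Q Q' :=
  exists (n : nat) (T : nat -> set V),
    [/\ T 0%N = Q, T n = Q', forall i, (i <= n)%N -> Sigma (T i) &
        forall i, (i < n)%N -> exists2 e, d = e.+1 & has_dim (T i `&` T i.+1) e].

Lemma chained_cons d Sigma Q1 Q2 Q3 e : Sigma Q1 -> d = e.+1 ->
  has_dim (Q1 `&` Q2) e -> chained d Sigma Q2 Q3 -> chained d Sigma Q1 Q3.
Proof.
move=> SQ1 de dim12 [n [T [T0 Tn ST dT]]].
exists n.+1, (fun i => if i is j.+1 then T j else Q1); split=> // [[|i]//|[|i]].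
- exact: ST.
- by exists e; rewrite // T0.
- exact: dT.
Qed.

Lemma card_S_ge2 : (2 <= #|S|)%N.
Proof. exact: leq_trans (Sp_ge2 (Ordinal k_gt0)) (max_card _). Qed.

(** Climb by pivots towards w', the unique maximum of an exposing form g; the
    number of vertices with a larger value of g decreases. *)
Lemma cells_chained w w' : vertex c w -> vertex c w' ->
  chained #|S|.-1 cells (cell w) (cell w').
Proof.
move=> + w'V; have [g [g0 gmax guniq]] := vertex_exposed w'V.
have [N] := ubnP #|[pred n | dot g w < dot g (vtx n)]|.
elim: N w => // N IH w ltN wV.
have [eq_ww'|ne_ww'] := eqVneq (dot g w) (dot g w').
  have ww' := guniq w (proj1 wV) eq_ww'.
  exists 0%N, (fun=> cell w); split=> //; first exact: cell_same_point.
  by move=> i _; exists w.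
have lt_ww' : dot g w < dot g w' by rewrite lt_neqAle ne_ww' gmax//; case: wV.
have [C Cw] := cuts wV.
have [i [l [t [til t_gt0 pV lt_wp]]]] := pivot_up wV Cw g0 (proj1 w'V) lt_ww'.
apply: (chained_cons (e := #|S|.-2) (Q2 := cell (pivot_by w C i l t))).
- by exists w.
- by have := card_S_ge2; lia.
- rewrite (cell_pivot _ wV til)//; last by case: pV.
    exact: (facet_dim clsP wV Cw k_gt0 Sp_gt0 Sp_ge2 til).
  by rewrite gt_eqF.
apply: (IH _ _ pV); apply: leq_trans (ltN : (_ <= N)%N).
have [m /(dot_same_point g0) mE] := vtx_surj pV.
apply: proper_card; apply/properP; split.
  by apply/fintype.subsetP => n; rewrite !inE; apply: lt_trans.
by exists m; rewrite !inE -mE ?ltxx.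
Qed.

Theorem cells_subdivision : matroid_subdivision k cells.
Proof.
split; last first.
  apply/seteqP; split=> [x [_ [w _ <-] []]//|x /cells_cover[w wV xw]].
  by exists (cell w) => //; exists w.
split; last first.
  move=> _ [w wV <-]; exists (gammoid Sp (tight c w)); last by rewrite cell_gammoid.
  exact: transversal_is_matroid.
split.
- have -> : cells = [set cell (vtx n) | n in [set: 'I_('C(2 * k - 2, k.-1))]].
    apply/seteqP; split=> _ [w wV <-]; last by exists (vtx w).
    by have [n /cell_same_point ->] := vtx_surj wV; exists n.
  exact/finite_image/finite_finset.
- move=> _ [w wV <-]; split; last by move=> x [].
  rewrite -cell_gammoid//; exists [set indicator R B | B in
    [set B | B \in bases (gammoid Sp (tight c w))]] => //.
  exact/finite_image/finite_finset.
- move=> _ _ [w [wF _] <-] [w' [w'F _] <-] _; split; first exact: cell_face.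
  by rewrite setIC; apply: cell_face.
exists #|S|.-1 => [_ [w wV <-]|_ _ [w wV <-] [w' w'V <-]].
  by have [C Cw] := cuts wV; apply: (cell_dim clsP wV Cw).
exact: cells_chained.
Qed.

End Subdivision.

(** * Coordinates on the tropical torus *)

Section TorusCoordinates.
Variables (R : realType) (k : nat).
Implicit Types (w : torus R k) (x : 'I_k -> R).

Definition coords w : 'I_k -> R := fun j => torus_repr w 0 j.

Definition point x : torus R k := torus_pi (\row_j x j).

Lemma coords_pi (r : 'rV[R]_k) :
  exists a, forall j, coords (torus_pi r) j = r 0 j + a.
Proof.
have /torus_piP[a /rowP e] : torus_pi (torus_repr (torus_pi r)) = torus_pi r.
  by rewrite torus_reprK.
by exists a => j; have := e j; rewrite !mxE /coords; lra.
Qed.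

Lemma coords_point x : same_point (coords (point x)) x.
Proof. by move=> i j; have [a e] := coords_pi (\row_j x j); rewrite !e !mxE; lra. Qed.

Lemma same_point_torus w w' : same_point (coords w) (coords w') -> w = w'.
Proof.
case: (posnP k) => [k0 _|k_gt0 ww'].
  rewrite -(torus_reprK w) -(torus_reprK w'); congr torus_pi.
  by apply/rowP => -[i ltik]; exfalso; rewrite k0 in ltik.
rewrite -(torus_reprK w) -(torus_reprK w'); apply/torus_piP.
exists (coords w (Ordinal k_gt0) - coords w' (Ordinal k_gt0)).
by apply/rowP => j; rewrite !mxE; have := ww' (Ordinal k_gt0) j; rewrite /coords; lra.
Qed.

Lemma coords_linear (a : R) w w' :
  exists b, forall j, coords (a *: w + w') j = a * coords w j + coords w' j + b.
Proof.
have [b e] := coords_pi (a *: torus_repr w + torus_repr w'); exists b => j.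
have := e j; rewrite linearP /= !torus_reprK => ->.
by rewrite !mxE.
Qed.

Definition torus_form (g : 'I_k -> R) (w : torus R k) : R^o := dot g (coords w).

Lemma torus_form_linear g : \sum_j g j = 0 -> linear (torus_form g).
Proof.
move=> g0 a w w'; have [b e] := coords_linear a w w'.
rewrite /torus_form /dot scaler_sumr -big_split /=.
rewrite (eq_bigr (fun j => a *: (g j * coords w j : R^o) + g j * coords w' j + g j * b)).
  by rewrite big_split /= -mulr_suml g0 mul0r addr0.
by move=> j _; rewrite e /GRing.scale /=; ring.
Qed.

(** The coordinates of a class depend on the chosen representative, but a form
    whose coefficients sum to zero does not see this choice. *)
Lemma torus_form_ex g : \sum_j g j = 0 ->
  exists f : {linear torus R k -> R^o}, forall w, f w = dot g (coords w).
Proof.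
move=> g0.
pose fM := GRing.isLinear.Build R (torus R k) R^o *:%R (torus_form g) (torus_form_linear g0).
pose f : {linear torus R k -> R^o} := HB.pack (torus_form g) fM.
by exists f.
Qed.

Variable c : 'I_k -> 'I_k -> R.

Lemma feasible_same_point u x : same_point u x -> feasible c u -> feasible c x.
Proof. by move=> ux uF i j; rewrite -ux. Qed.

Definition alcoved : set (torus R k) := [set w | feasible c (coords w)].

Lemma alcoved_point x : alcoved (point x) <-> feasible c x.
Proof.
split; apply: feasible_same_point; first exact: coords_point.
exact/same_point_sym/coords_point.
Qed.

(** A vertex of the potential polytope is exposed by [vertex_exposed].
    Conversely, if a set A is a union of components of the graph of w, then w
    can be moved both ways along the indicator of A inside the polytope.  An
    exposing form f is then constant along this direction, so the direction is
    zero in the torus, that is, A is empty or everything. *)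
Lemma Vert_vertex w : Vert alcoved w <-> vertex c (coords w).
Proof.
split=> [[f [m [f_le face]]]|wV]; last first.
  have [g [g0 gmax guniq]] := vertex_exposed wV.
  have [f fE] := torus_form_ex g0; exists f, (dot g (coords w)).
  split=> [u uF|]; first by rewrite fE; apply: gmax.
  apply/seteqP; split=> [_ ->|u [uF /= fu]]; first by split; [case: wV|exact: fE].
  by apply/same_point_torus/guniq; rewrite // -fE.
have [wF fw] : alcoved w /\ f w = m by have : [set w] w by []; rewrite face.
split=> // A Acl; pose ind : 'I_k -> R := fun j => (A j)%:R.
pose sl (ij : 'I_k * 'I_k) := if A ij.1 == A ij.2 then 1
  else c ij.1 ij.2 - (coords w ij.2 - coords w ij.1).
have [|e e_gt0 e_sl] := finite_margin (s := sl).
  case=> i j; rewrite /sl /=; case: ifP => // Aij; rewrite subr_gt0 lt_neqAle wF andbT.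
  apply: contraFN (Aij) => tij; apply/eqP/Acl; rewrite /tight tij andbT.
  by apply: contraFneq Aij => ->.
have moved s : point (fun j => coords w j + s * ind j) = w + s *: point ind.
  rewrite /point -linearZ -[w in RHS]torus_reprK -linearD; congr torus_pi.
  by apply/rowP => j; rewrite !mxE.
have moved_alcoved s : - e <= s <= e -> alcoved (w + s *: point ind).
  move=> s_e; rewrite -moved; apply/alcoved_point => i j.
  have := e_sl (i, j); have := wF i j; rewrite /sl /ind /=.
  by case: (A i); case: (A j) => /=; lra.
have f_ind : f (point ind) = 0.
  have := f_le _ (moved_alcoved e _); have := f_le _ (moved_alcoved (- e) _).
  rewrite !linearD !linearZ /= fw /GRing.scale /= => le1 le2.
  apply/eqP; rewrite -(mulrI_eq0 _ (mulfI (lt0r_neq0 e_gt0))); apply/eqP.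
  have := le1 ltac:(lra); have := le2 ltac:(lra); lra.
have : [set w] (w + e *: point ind).
  rewrite face; split; first by apply: moved_alcoved; lra.
  by rewrite /= linearD linearZ /= f_ind scaler0 addr0.
rewrite /= -moved => eq_w i j.
have := coords_point (fun j => coords w j + e * ind j) i j; rewrite eq_w /ind.
by case: (A i); case: (A j) => /=; lra.
Qed.
End TorusCoordinates.

(** * Gammoids of a maximal biconvex polytope *)

Theorem mainTheorem1 (R : realType) (k : nat) (P : set (torus R k))
    (v : 'I_k -> torus R k) (S : finType) (Sp : 'I_k -> {set S}) :
  (1 <= k)%N ->
  maximal_biconvex P ->
  injective v ->
  minimal_generating_set P (range v) ->
  P = \bigcap_i max_sector (v i) i ->
  is_partition Sp ->
  (forall i, (2 <= #|Sp i|)%N) ->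
  matroid_subdivision k
    [set base_polytope (R:=R) (gammoid Sp (vertex_graph v w)) | w in Vert P].
Proof.
move=> k_gt0 [_ _ card_P] _ [tconv_P _] sectors_P [Sp_cover Sp_disj] Sp_ge2.
pose c i j := coord_diff (v i) j i.
have PE : P = alcoved c.
  rewrite sectors_P; apply/seteqP; split=> w wP; last by move=> i _ j _; apply: wP.
  move=> i j; have [->|ji] := eqVneq j i; last exact: wP.
  by rewrite /c /coord_diff !subrr.
have c_tri i j l : c i l <= c i j + c j l.
  have : P (v i) by rewrite tconv_P; apply: sub_gen_smallest; exists i.
  by rewrite PE => /(_ j l); rewrite /c /coords /coord_diff; lra.
have [cls clsP] : exists cls : S -> 'I_k, forall s i, (s \in Sp i) = (cls s == i).
  have /boolp.choice[cls clsP] : forall s, exists i, s \in Sp i.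
    move=> s; have : s \in (\bigcup_i Sp i)%SET by rewrite Sp_cover finset.in_setT.
    by case/bigcupP => i _ si; exists i.
  exists cls => s i; have [<-|ne] := eqVneq (cls s) i; first exact: clsP.
  by rewrite (disjointFr (Sp_disj _ _ ne) (clsP s)).
have [f [f_fun f_inj f_surj]] := elimT card_set_bijP card_P.
have /boolp.choice[vt vtP] : forall n : 'I_('C(2 * k - 2, k.-1)),
    exists w, Vert P w /\ f w = n.
  by move=> n; have [w wP wn] := f_surj n (ltn_ord n); exists w.
pose vtx n := coords (vt n).
have vtx_vertex n : vertex c (vtx n).
  by apply/Vert_vertex; rewrite -PE; case: (vtP n).
have vtx_inj m n : same_point (vtx m) (vtx n) -> m = n.
  move/same_point_torus => e; apply: val_inj => /=.
  by case: (vtP m) => _ <-; case: (vtP n) => _ <-; rewrite e.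
have vtx_surj x : vertex c x -> exists n, same_point x (vtx n).
  move=> xV; have pV : Vert P (point x).
    rewrite PE; apply/Vert_vertex; case: xV => xF xC; split.
      exact: feasible_same_point (same_point_sym (coords_point x)) xF.
    by rewrite (same_point_tight _ (coords_point x)).
  have lt_f := f_fun _ pV; exists (Ordinal lt_f).
  have -> : vtx (Ordinal lt_f) = coords (point x).
    have [wV wf] := vtP (Ordinal lt_f); congr coords.
    by apply: f_inj; rewrite ?inE.
  exact/same_point_sym/coords_point.
have -> : [set base_polytope (R:=R) (gammoid Sp (vertex_graph v w)) | w in Vert P] =
    cells cls c.
  have graphE w : P w -> vertex_graph v w = tight c (coords w).
    move=> wP; apply/funext => i; apply/funext => l.
    rewrite /vertex_graph /facet_indices /sector_indices !inE /tight eq_sym.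
    have sec : max_sector (v i) i w by move: wP; rewrite sectors_P; apply.
    have facetE : sector_facet (v i) i l w <-> coords w l - coords w i = c i l.
      by split=> [[]|].
    have [//|li] := eqVneq l i; rewrite /=.
      by rewrite andbF.
    apply/andP/eqP => [[_ /asboolP/facetE]//|/facetE fac]; split; apply/asboolP => //.
    by exists l.
  have gam w : vertex c (coords w) ->
      base_polytope (R := R) (gammoid Sp (vertex_graph v w)) = cell cls c (coords w).
    move=> wV; rewrite graphE; last by rewrite PE; case: wV.
    exact: (cell_gammoid k_gt0 clsP Sp_ge2 c_tri vtx_vertex vtx_inj vtx_surj).
  apply/seteqP; split=> Q.
    move=> [w]; rewrite PE => /Vert_vertex wV <-; exists (coords w) => //.
    by rewrite gam.
  move=> [x xV <-]; have [n xn] := vtx_surj x xV; exists (vt n).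
    by case: (vtP n).
  by rewrite gam ?(cell_same_point cls c xn)//; apply: vtx_vertex.
exact: (cells_subdivision k_gt0 clsP Sp_ge2 c_tri vtx_vertex vtx_inj vtx_surj).
Qed.
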